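(* Let $N\ge2$ and $\mu_1\le\mu_2\le\cdots\le\mu_N<0$. Then the system $$-u_i''-2\Big(\sum_{j=1}^Nu_j^2\Big)u_i=\mu_iu_i\quad\text{in }\mathbb{R},\qquad i=1,\dots,N,$$ does not admit any solution $u=(u_1,\dots,u_N)\in H^1(\mathbb{R})^N$ whose components are pairwise orthogonal in $L^2(\mathbb{R})$ and have the same nonzero $L^2(\mathbb{R})$-norm.
   Context: All functions are real-valued; equations for $H^1$ functions are understood in the distributional sense. *)

(* Defs.v *)
From HB Require Import structures.
From mathcomp Require Import all_boot all_order all_algebra.
From mathcomp Require Import all_classical all_reals all_analysis.
Set Implicit Arguments.
Unset Strict Implicit.
Unset Printing Implicit Defensive.
Import Order.TTheory GRing.Theory Num.Theory.
Import numFieldNormedType.Exports.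
Local Open Scope classical_set_scope.
Local Open Scope ring_scope.

Definition test_function (R : realType) (phi : R -> R) : Prop :=
  (forall (n : nat) (x : R), derivable (derive1n n phi) x 1) /\
  compact (closure [set x | phi x != 0]).

(* A distribution is represented by its action on arbitrary functions; only
   its values on test functions are meaningful. *)
Definition distr_of (R : realType) (f : R -> R) : (R -> R) -> R :=
  fun phi => \int[lebesgue_measure]_x (f x * phi x).

Definition distr_deriv (R : realType) (T : (R -> R) -> R) : (R -> R) -> R :=
  fun phi => - T (derive1 phi).

(* Elements of L^2 and H^1 are represented by Borel functions, not by their
   classes modulo equality almost everywhere. *)
Definition H1 (R : realType) (u : R -> R) : Prop :=
  u \in Lfun lebesgue_measure 2%:E /\
  exists2 v : R -> R, v \in Lfun lebesgue_measure 2%:E &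
    forall phi, test_function phi ->
      distr_deriv (distr_of u) phi = distr_of v phi.

(* For u i in H^1 all the integrals below converge, because H^1(R) is contained
   in L^oo(R). *)
Definition solves_system (R : realType) (N : nat) (mu : 'I_N -> R)
    (u : 'I_N -> R -> R) : Prop :=
  forall (i : 'I_N) (phi : R -> R), test_function phi ->
    - distr_deriv (distr_deriv (distr_of (u i))) phi
    - 2 * distr_of (fun x => (\sum_(j < N) u j x ^+ 2) * u i x) phi
    = mu i * distr_of (u i) phi.

(* Main.v *)
Require Import Defs.
From mathcomp Require Import all_boot all_order all_algebra.
From mathcomp Require Import all_classical all_reals all_analysis.
From mathcomp Require Import measurable_realfun ring lra.
Import Order.TTheory GRing.Theory Num.Theory.
Import numFieldNormedType.Exports.
Local Open Scope classical_set_scope.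
Local Open Scope ring_scope.

(** Weak solutions agree almost everywhere with classical ones U_i, and with
    mu_i = - k_i^2 one considers the Gram matrix
    G_ij(x) = \int_(t <= x) U_i(t) U_j(t) dt, so that G' = U U^T.
    The multisoliton identities
      d := U' - K U + G U = 0,      E := K G + G K - G^2 - U U^T = 0
    hold, where K = diag(k_i).  Indeed d' = - (K - G) d + E U and
    E' = - (d U^T + U d^T), whence (|d|^2 + |E|^2 / 2)' = - 2 d.(K - G) d.  Near -oo
    the matrix G is small, so this energy is nonincreasing there; it tends to 0
    along a sequence going to -oo, hence it vanishes near -oo, and everywhere by
    Gronwall's lemma.  At +oo, G tends to m I, where m is the common value of
    the squared norms, and E_ii = 0 gives 2 k_i = m.  So all the mu_i coincide,
    the Wronskian of U_0 and U_1 is constant, hence zero, U_0 and U_1 are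
    proportional, and they cannot be orthogonal.

    For the regularity, the weak formulation is tested against steep smooth
    approximations of the indicator of [a, b]: at Lebesgue points a and b this
    gives f(b) - f(a) = \int_[a, b] h whenever h is the weak derivative of f. *)

(** * Differential inequalities on the line *)

Section Derive.
Context {R : realType}.
Implicit Types (f g : R -> R) (x a b : R).

Lemma is_derive1D f g x a b : is_derive x 1 f a -> is_derive x 1 g b ->
  is_derive x 1 (fun y => f y + g y) (a + b).
Proof. by move=> fa gb; exact: is_deriveD. Qed.

Lemma is_derive1N f x a : is_derive x 1 f a ->
  is_derive x 1 (fun y => - f y) (- a).
Proof. by move=> fa; exact: is_deriveN. Qed.

Lemma is_derive1M f g x a b : is_derive x 1 f a -> is_derive x 1 g b ->
  is_derive x 1 (fun y => f y * g y) (a * g x + f x * b).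
Proof.
move=> fa gb; have := is_deriveM fa gb; rewrite /GRing.scale /=.
by move=> h; apply: is_derive_eq h _; ring.
Qed.

Lemma is_derive1Z (c : R) f x a : is_derive x 1 f a ->
  is_derive x 1 (fun y => c * f y) (c * a).
Proof. by move=> fa; exact: is_deriveZ. Qed.

Lemma is_derive1_sum (I : finType) (F : I -> R -> R) (dF : I -> R) x :
  (forall i, is_derive x 1 (F i) (dF i)) ->
  is_derive x 1 (fun y => \sum_i F i y) (\sum_i dF i).
Proof.
move=> h.
have -> : (fun y => \sum_i F i y) = \sum_i F i.
  by apply/funext => y; rewrite fct_sumE.
elim/big_ind2: _ => [|f a g b fa gb|i _]; [exact: is_derive_cst|exact: is_deriveD|exact: h].
Qed.

Lemma is_derive1_nincr f (df : R -> R) a b : a <= b ->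
  (forall x, is_derive x 1 f (df x)) ->
  (forall x, a <= x <= b -> df x <= 0) -> f b <= f a.
Proof.
move=> ab fdf df0.
have [|c cab E] := @MVT_segment R f df a b ab (fun x _ => fdf x).
  apply: continuous_subspaceT => x.
  by apply/differentiable_continuous/derivable1_diffP; case: (fdf x).
rewrite -subr_le0 E mulr_le0_ge0 ?subr_ge0//.
by apply: df0; move: cab; rewrite in_itv.
Qed.

(** To the right of [x0] the function [f x * expR (- C * x)] is nonincreasing, to the left
    [f x * expR (C * x)] is nondecreasing. Both vanish at [x0], so [f <= 0] on either side. *)
Lemma gronwall_eq0 f (df : R -> R) (C x0 : R) :
  (forall x, is_derive x 1 f (df x)) -> (forall x, 0 <= f x) ->
  (forall x, `|df x| <= C * f x) -> f x0 = 0 -> forall x, f x = 0.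
Proof.
move=> fdf f0 dfC fx0 x.
have dE (k y : R) : is_derive y 1 (fun z => f z * expR (k * z))
    (df y * expR (k * y) + f y * (k * expR (k * y))).
  apply: is_derive1M => //.
  have h : is_derive y 1 (fun z => k * z) k.
    by have := is_derive1Z k _ y _ (is_derive_id y (1:R)); rewrite mulr1.
  by have := is_derive1_comp (is_derive_expR (k * y)) h; rewrite mulrC.
apply/eqP; rewrite eq_le f0 andbT.
case: (leP x0 x) => x0x.
- have := @is_derive1_nincr _ _ x0 x x0x (dE (- C)).
  rewrite fx0 mul0r pmulr_lle0 ?expR_gt0//; apply => y _.
  have := dfC y; rewrite ler_norml => /andP[_ h].
  have e0 : 0 < expR (- C * y) by exact: expR_gt0.
  rewrite mulrA -mulrDl pmulr_lle0//; lra.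
- have := @is_derive1_nincr _ _ x x0 (ltW x0x) (fun y => is_derive1N _ _ _ (dE C y)).
  rewrite fx0 mul0r oppr0 oppr_ge0 pmulr_lle0 ?expR_gt0//; apply => y _.
  have := dfC y; rewrite ler_norml => /andP[h _].
  have e0 : 0 < expR (C * y) by exact: expR_gt0.
  rewrite mulrA -mulrDl oppr_le0 pmulr_lge0//; lra.
Qed.

End Derive.

(** * The Riccati identity *)

(** The default value 1 of the minimum keeps it positive even for an empty family. *)
Lemma pos_family_lb (R : realType) (N : nat) (k : 'I_N -> R) :
  (forall i, 0 < k i) -> exists2 m, 0 < m & forall i, m <= k i.
Proof.
move=> k0; exists (\big[Num.min/1]_i k i); last first.
  by move=> i; rewrite bigmin_le_cond.
by elim/big_ind: _ => // x y x0 y0; rewrite lt_min x0.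
Qed.

Lemma family_ub (R : realType) (N : nat) (k : 'I_N -> R) :
  exists2 m, 0 <= m & forall i, k i <= m.
Proof.
exists (\sum_i `|k i|); first by exact: sumr_ge0.
move=> i; rewrite (le_trans (ler_norm _))// (bigD1 i)//= lerDl.
exact: sumr_ge0.
Qed.

Section Riccati.
Context {R : realType} {N : nat}.
Variables (k : 'I_N -> R) (u v : 'I_N -> R -> R) (G : 'I_N -> 'I_N -> R -> R).
Hypothesis du : forall i (x : R), is_derive x 1 (u i) (v i x).
Hypothesis dv : forall i (x : R), is_derive x 1 (v i)
  (- (2 * (\sum_j u j x ^+ 2)) * u i x + k i ^+ 2 * u i x).
Hypothesis dG : forall i j (x : R), is_derive x 1 (G i j) (u i x * u j x).
Hypothesis Gsym : forall i j (x : R), G i j x = G j i x.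

Definition first_order_defect (i : 'I_N) (x : R) : R :=
  v i x - k i * u i x + \sum_j G i j x * u j x.

Definition riccati_defect (i j : 'I_N) (x : R) : R :=
  (k i + k j) * G i j x - \sum_l G i l x * G l j x - u i x * u j x.

Local Notation d := first_order_defect.
Local Notation E := riccati_defect.

Lemma riccati_defect_sym i j x : E i j x = E j i x.
Proof.
rewrite /E (Gsym i j) (addrC (k i)) (mulrC (u i x)); congr (_ - _ - _).
by apply: eq_bigr => l _; rewrite (Gsym i) (Gsym l j) mulrC.
Qed.

(** Half of the cubic term $-2|u|^2u$ of [v'] is cancelled by $G'u=|u|^2u$; the other half is the
    contribution of $-uu^T$ to $Eu$. The remaining terms of $Eu$ complete $-Kv+Gv+K^2u$ to
    $-(K-G)d$. *)
Lemma is_derive_first_order_defect i (x : R) : is_derive x 1 (d i)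
  (- k i * d i x + \sum_j G i j x * d j x + \sum_j E i j x * u j x).
Proof.
have h : is_derive x 1 (d i)
    ((- (2 * (\sum_j u j x ^+ 2)) * u i x + k i ^+ 2 * u i x) + - (k i * v i x)
     + \sum_j (u i x * u j x * u j x + G i j x * v j x)).
  rewrite /first_order_defect; apply: is_derive1D.
  by apply: is_derive1_sum => j; exact: is_derive1M.
apply: is_derive_eq h _.
have -> : \sum_j (u i x * u j x * u j x + G i j x * v j x) =
    (\sum_j u j x ^+ 2) * u i x + \sum_j G i j x * v j x.
  by rewrite big_split /= mulr_suml; congr (_ + _); apply: eq_bigr => j _; ring.
have -> : \sum_j G i j x * d j x = \sum_j G i j x * v j x
   - \sum_j (k j * (G i j x * u j x)) + \sum_j \sum_l G i j x * G j l x * u l x.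
  rewrite -sumrB -big_split /=; apply: eq_bigr => j _.
  rewrite /d mulrDr mulr_sumr; congr (_ + _); first ring.
  by apply: eq_bigr => l _; ring.
have -> : \sum_j E i j x * u j x = \sum_j (k j * (G i j x * u j x))
   + k i * (\sum_j G i j x * u j x)
   - \sum_j \sum_l G i j x * G j l x * u l x - (\sum_j u j x ^+ 2) * u i x.
  rewrite exchange_big /= mulr_sumr mulr_suml -big_split/= -!sumrB.
  apply: eq_bigr => j _.
  by rewrite /E !mulrBl mulr_suml; congr (_ - _ - _); ring.
by rewrite /d; ring.
Qed.

(** Since $G'=uu^T$, differentiating $KG+GK-G^2$ produces the parts $-Ku$ and $Gu$ of [d] against
    [u], and differentiating $uu^T$ produces the part [v]. Symmetry of [G] turns $u^TG$ into
    $(Gu)^T$. *)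
Lemma is_derive_riccati_defect i j (x : R) : is_derive x 1 (E i j)
  (- (d i x * u j x + u i x * d j x)).
Proof.
have h : is_derive x 1 (E i j)
    ((k i + k j) * (u i x * u j x)
     - \sum_l (u i x * u l x * G l j x + G i l x * (u l x * u j x))
     - (v i x * u j x + u i x * v j x)).
  rewrite /riccati_defect; apply: is_derive1D; last by apply: is_derive1N; exact: is_derive1M.
  apply: is_derive1D.
  by apply: is_derive1N; apply: is_derive1_sum => l; exact: is_derive1M.
apply: is_derive_eq h _.
have -> : \sum_l (u i x * u l x * G l j x + G i l x * (u l x * u j x)) =
  u i x * (\sum_l G j l x * u l x) + (\sum_l G i l x * u l x) * u j x.
  rewrite mulr_sumr mulr_suml -big_split/=; apply: eq_bigr => l _.
  by rewrite (Gsym l j); ring.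
by rewrite /d; ring.
Qed.

(** The weight [2^-1] compensates for the two mixed terms that each entry of [E] contributes to the
    derivative. *)
Definition defect_energy (x : R) : R :=
  \sum_i d i x ^+ 2 + 2^-1 * \sum_i \sum_j E i j x ^+ 2.

Definition defect_form (x : R) : R :=
  \sum_i k i * d i x ^+ 2 - \sum_i \sum_j G i j x * (d i x * d j x).

Lemma defect_energy_ge0 x : 0 <= defect_energy x.
Proof.
rewrite addr_ge0 ?mulr_ge0 ?invr_ge0//; apply: sumr_ge0 => i _.
  exact: sqr_ge0.
by apply: sumr_ge0 => j _; exact: sqr_ge0.
Qed.

Lemma defect_energy_le x : \sum_i d i x ^+ 2 <= defect_energy x.
Proof.
rewrite lerDl mulr_ge0 ?invr_ge0//; apply: sumr_ge0 => i _.
by apply: sumr_ge0 => j _; exact: sqr_ge0.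
Qed.

(* The mixed terms d.Eu cancel because E is symmetric. *)
Lemma is_derive_defect_energy (x : R) :
  is_derive x 1 defect_energy (- 2 * defect_form x).
Proof.
have sq (f : R -> R) a : is_derive x 1 f a ->
    is_derive x 1 (fun y => f y ^+ 2) (2 * (f x * a)).
  move=> fa; have := is_derive1M _ _ _ _ _ fa fa => h.
  by apply: is_derive_eq h _; ring.
have h : is_derive x 1 defect_energy
    (\sum_i 2 * (d i x * (- k i * d i x + \sum_j G i j x * d j x
        + \sum_j E i j x * u j x))
     + 2^-1 * \sum_i \sum_j 2 * (E i j x * - (d i x * u j x + u i x * d j x))).
  rewrite /defect_energy; apply: is_derive1D.
    apply: is_derive1_sum => i; apply: sq; exact: is_derive_first_order_defect.
  apply: is_derive1Z; apply: is_derive1_sum => i; apply: is_derive1_sum => j.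
  by apply: sq; exact: is_derive_riccati_defect.
apply: is_derive_eq h _.
have -> : \sum_i \sum_j 2 * (E i j x * - (d i x * u j x + u i x * d j x)) =
   - 4 * \sum_i \sum_j d i x * (E i j x * u j x).
  transitivity (- 2 * (\sum_i \sum_j d i x * (E i j x * u j x)) +
                - 2 * (\sum_i \sum_j d j x * (E i j x * u i x))).
    rewrite !mulr_sumr -big_split/=; apply: eq_bigr => i _.
    rewrite !mulr_sumr -big_split/=; apply: eq_bigr => j _; ring.
  rewrite [X in _ + _ * X]exchange_big/=.
  under [X in _ + _ * X]eq_bigr do under eq_bigr do rewrite riccati_defect_sym.
  by ring.
rewrite /defect_form mulrBr !mulr_sumr -!sumrN -!big_split/=.
apply: eq_bigr => i _.
rewrite -!mulr_sumr.
under [X in _ = _ - _ * X]eq_bigr do rewrite mulrCA.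
by rewrite -mulr_sumr; field.
Qed.

(** From $|d_id_j|\le(d_i^2+d_j^2)/2$, summed over both indices. *)
Lemma defect_form_bound (B x : R) : (forall i j, `|G i j x| <= B) ->
  `|\sum_i \sum_j G i j x * (d i x * d j x)| <= N%:R * B * \sum_i d i x ^+ 2.
Proof.
move=> GB.
apply: (@le_trans _ _ (\sum_i \sum_j B * (2^-1 * (d i x ^+ 2 + d j x ^+ 2)))).
  apply: (le_trans (ler_norm_sum _ _ _)); apply: ler_sum => i _.
  apply: (le_trans (ler_norm_sum _ _ _)); apply: ler_sum => j _.
  rewrite normrM ler_pM//.
  have := sqr_ge0 (d i x - d j x); have := sqr_ge0 (d i x + d j x).
  by rewrite ler_norml => h1 h2; apply/andP; split; nra.
under eq_bigr => i _ do rewrite -!mulr_sumr big_split/= sumr_const card_ord.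
rewrite -!mulr_sumr big_split/= sumr_const card_ord sumrMnl -mulr_natl.
by rewrite le_eqVlt; apply/orP; left; apply/eqP; field.
Qed.

Hypothesis k_gt0 : forall i, 0 < k i.
Hypothesis G_bounded : exists B, forall i j x, `|G i j x| <= B.
Hypothesis G_Ny : forall e : R, 0 < e ->
  exists X, forall i j x, x <= X -> `|G i j x| <= e.
Hypothesis uv_Ny : forall e X : R, 0 < e ->
  exists2 x, x <= X & forall i, `|u i x| <= e /\ `|v i x| <= e.

(** To the left of [X] the matrix [K - G] is positive semidefinite, so the energy does not increase
    there. Its value at [X] is therefore at most its value at points arbitrarily far to the left,
    and some of these make it as small as desired. *)
Lemma defect_energy_eq0_Ny : exists x, defect_energy x = 0.
Proof.
have [m m0 mk] := pos_family_lb _ _ _ k_gt0.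
have [M M0 kM] := family_ub _ _ k.
(* With entries of size at most [m / N.+1%:R], the form of [G] is at most
   [N%:R * (m / N.+1%:R) <= m] times $|d|^2$, which the form of [K] dominates. *)
have [|X GX] := G_Ny (m / N.+1%:R); first by rewrite divr_gt0.
have form_ge0 x : x <= X -> 0 <= defect_form x.
  move=> xX; rewrite subr_ge0 (le_trans (ler_norm _))//.
  apply: le_trans (defect_form_bound (m / N.+1%:R) x _) _ => [i j|].
    exact: GX.
  apply: (@le_trans _ _ (m * \sum_i d i x ^+ 2)).
    apply: ler_wpM2r; first by apply: sumr_ge0 => i _; exact: sqr_ge0.
    rewrite mulrCA ger_pMr// ler_pdivrMr// mul1r ler_nat//.
  by rewrite mulr_sumr; apply: ler_sum => i _; rewrite ler_wpM2r ?sqr_ge0.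
exists X; apply/eqP; rewrite eq_le defect_energy_ge0 andbT.
apply/ler_addgt0Pr => e e0; rewrite add0r.
(* If all entries of [u], [v] and [G] are at most [t <= 1] in absolute value, then [C1 * t] bounds
   each [d i], [C2 * t] bounds each [E i j], and [C * t] bounds the energy. The condition [t <= 1]
   allows [t ^+ 2] to be replaced by [t]. *)
pose C1 := 1 + M + N%:R : R.
pose C2 := M + M + N%:R + 1 : R.
pose C := N%:R * C1 ^+ 2 + 2^-1 * (N%:R * (N%:R * C2 ^+ 2)).
have n0 : 0 <= N%:R :> R by [].
have C10 : 0 <= C1 by rewrite /C1; lra.
have C20 : 0 <= C2 by rewrite /C2; lra.
have C0 : 0 <= C by rewrite addr_ge0 ?mulr_ge0 ?exprn_ge0.
have [t [t0 t1 tC]] : exists t : R, [/\ 0 < t, t <= 1 & C * t <= e].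
  exists (Num.min 1 (e / (C + 1))); split.
  - by rewrite lt_min ltr01 divr_gt0// ltr_wpDl.
  - by rewrite ge_min lexx.
  - apply: (@le_trans _ _ (C * (e / (C + 1)))).
      by rewrite ler_wpM2l// ge_min lexx orbT.
    rewrite mulrCA ger_pMr// ler_pdivrMr; lra.
have [Y GY] := G_Ny t t0.
have [x xX uvx] := uv_Ny t (Num.min X Y) t0.
move: xX; rewrite le_min => /andP[xX xY].
have := @is_derive1_nincr R _ _ x X xX is_derive_defect_energy.
move=> /(_ _)/le_trans; apply.
  by move=> y /andP[_ yX]; have := form_ge0 y yX; lra.
have Gx i j : `|G i j x| <= t by exact: GY.
have ux i : `|u i x| <= t by case: (uvx i).
have vx i : `|v i x| <= t by case: (uvx i).
have kM' i : `|k i| <= M by rewrite gtr0_norm.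
have dx i : `|d i x| <= C1 * t.
  rewrite /d /C1 !mulrDl mul1r.
  apply: le_trans (ler_normD _ _) _; apply: lerD.
    apply: le_trans (ler_normB _ _) _; rewrite lerD// normrM ler_pM//.
  apply: le_trans (ler_norm_sum _ _ _) _.
  rewrite mulr_natl -[X in _ *+ X](card_ord N) -sumr_const ler_sum// => j _.
  by rewrite normrM -[leRHS]mulr1 ler_pM// (le_trans (ux j)).
have Ex i j : `|E i j x| <= C2 * t.
  rewrite /E /C2 !mulrDl mul1r.
  apply: le_trans (ler_normB _ _) _; apply: lerD; last first.
    by rewrite normrM -[leRHS]mulr1 ler_pM// (le_trans (ux j)).
  apply: le_trans (ler_normB _ _) _; apply: lerD.
    by rewrite -!mulrDl normrM ler_pM// (le_trans (ler_normD _ _))// lerD.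
  apply: le_trans (ler_norm_sum _ _ _) _.
  rewrite mulr_natl -[X in _ *+ X](card_ord N) -sumr_const ler_sum// => l _.
  by rewrite normrM -[leRHS]mulr1 ler_pM// (le_trans (Gx l j)).
have sqb (a b : R) : 0 <= b -> `|a| <= b * t -> a ^+ 2 <= b ^+ 2 * t.
  move=> b0 ab; rewrite -real_normK ?num_real//.
  apply: (@le_trans _ _ ((b * t) ^+ 2)).
    by rewrite ler_sqr ?nnegrE// mulr_ge0// ltW.
  by rewrite exprMn ler_wpM2l ?sqr_ge0// expr2 ger_pMr.
apply: le_trans tC; rewrite /defect_energy /C [leRHS]mulrDl.
apply: lerD.
  rewrite -mulrA mulr_natl -[X in _ *+ X](card_ord N) -sumr_const ler_sum// => i _.
  exact: sqb.
rewrite -!mulrA ler_wpM2l ?invr_ge0//.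
rewrite mulr_natl -[X in _ *+ X](card_ord N) -sumr_const ler_sum// => i _.
rewrite mulr_natl -[X in _ *+ X](card_ord N) -sumr_const ler_sum// => j _.
by rewrite mulrA -expr2; exact: sqb.
Qed.

(** As [G] is bounded, the derivative of the energy is at most [2 * (M + N%:R * B)] times the energy
    in absolute value. Gronwall's lemma thus carries the zero found far to the left to the whole
    line, and every square in the energy vanishes. *)
Lemma riccati i j x :
  (k i + k j) * G i j x - \sum_l G i l x * G l j x = u i x * u j x.
Proof.
have [x0 x0E] := defect_energy_eq0_Ny.
have [B GB] := G_bounded.
have [M M0 kM] := family_ub _ _ k.
have E0 : defect_energy x = 0.
  apply: (@gronwall_eq0 R _ _ (2 * (M + N%:R * B)) x0 is_derive_defect_energy) => //.
    exact: defect_energy_ge0.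
  move=> y; rewrite normrM -mulrA normrN [`|2|]ger0_norm// ler_wpM2l//.
  have D0 : 0 <= \sum_i d i y ^+ 2 by apply: sumr_ge0 => l _; exact: sqr_ge0.
  have B0 : 0 <= B by exact: le_trans (normr_ge0 _) (GB i j x).
  apply: (@le_trans _ _ ((M + N%:R * B) * \sum_i d i y ^+ 2)); last first.
    by rewrite ler_wpM2l ?defect_energy_le// addr_ge0 ?mulr_ge0.
  rewrite mulrDl; apply: le_trans (ler_normB _ _) _; apply: lerD.
    rewrite ger0_norm; last first.
      by apply: sumr_ge0 => l _; rewrite mulr_ge0 ?sqr_ge0// ltW.
    by rewrite mulr_sumr ler_sum// => l _; rewrite ler_wpM2r ?sqr_ge0.
  by apply: defect_form_bound => *; exact: GB.
suff : E i j x = 0 by rewrite /E => /eqP; rewrite subr_eq0 => /eqP.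
have S0 : \sum_i \sum_j E i j x ^+ 2 = 0.
  have D0 : 0 <= \sum_i d i x ^+ 2 by apply: sumr_ge0 => l _; exact: sqr_ge0.
  have S0 : 0 <= \sum_i \sum_j E i j x ^+ 2.
    by apply: sumr_ge0 => a _; apply: sumr_ge0 => b _; exact: sqr_ge0.
  by move: E0; rewrite /defect_energy => h; apply/eqP; rewrite eq_le S0 andbT; lra.
apply/eqP; rewrite -sqrf_eq0; apply/eqP.
have h1 : \sum_j E i j x ^+ 2 = 0.
  apply: psumr_eq0P S0 i isT => a _.
  by apply: sumr_ge0 => b _; exact: sqr_ge0.
by apply: psumr_eq0P h1 j isT => b _; exact: sqr_ge0.
Qed.

End Riccati.

(** * Classical solutions *)

(** Replaces passages to the limit at infinity: it suffices to estimate at one well chosen point for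
    each [e]. The restriction [e <= 1] lets products of small quantities be bounded by [e]. *)
Lemma eq0_of_small (R : realType) (x C : R) :
  (forall e, 0 < e -> e <= 1 -> `|x| <= C * e) -> x = 0.
Proof.
move=> h; apply/eqP/negPn/negP => x0.
have nx : 0 < `|x| by rewrite normr_gt0.
have C0 : 0 < C by have := h 1 ltr01 (lexx _); rewrite mulr1; exact: lt_le_trans.
pose e := Num.min 1 (`|x| / (2 * C)).
have e0 : 0 < e by rewrite lt_min ltr01 divr_gt0// mulr_gt0.
have e1 : e <= 1 by rewrite /e ge_min lexx.
have := h e e0 e1; apply/negP; rewrite -ltNge.
apply: (@le_lt_trans _ _ (C * (`|x| / (2 * C)))).
  by rewrite ler_wpM2l ?(ltW C0)// /e ge_min lexx orbT.
have -> : C * (`|x| / (2 * C)) = `|x| / 2 by field; rewrite gt_eqF.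
by rewrite ltr_pdivrMr// mulr_natr mulr2n ltrDl.
Qed.

Section NoRegularSolution.
Context {R : realType} {N : nat}.
Variables (k : 'I_N -> R) (u v : 'I_N -> R -> R) (G : 'I_N -> 'I_N -> R -> R).
Variable m : R.
Hypothesis du : forall i (x : R), is_derive x 1 (u i) (v i x).
Hypothesis dv : forall i (x : R), is_derive x 1 (v i)
  (- (2 * (\sum_j u j x ^+ 2)) * u i x + k i ^+ 2 * u i x).
Hypothesis dG : forall i j (x : R), is_derive x 1 (G i j) (u i x * u j x).
Hypothesis Gsym : forall i j (x : R), G i j x = G j i x.
Hypothesis k_gt0 : forall i, 0 < k i.
Hypothesis m_gt0 : 0 < m.
Hypothesis G_bounded : exists B, forall i j x, `|G i j x| <= B.
Hypothesis G_Ny : forall e : R, 0 < e ->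
  exists X, forall i j x, x <= X -> `|G i j x| <= e.
Hypothesis uv_Ny : forall e X : R, 0 < e ->
  exists2 x, x <= X & forall i, `|u i x| <= e /\ `|v i x| <= e.
Hypothesis uG_y : forall e : R, 0 < e ->
  exists x, forall i j, `|u i x| <= e /\ `|G i j x - m *+ (i == j)| <= e.

Let ric := @riccati R N k u v G du dv dG Gsym k_gt0 G_bounded G_Ny uv_Ny.

(** The diagonal Riccati identity at +oo, where [G] tends to [m] times the identity and [u] is small
    along a sequence, reads $2k_im-m^2=0$. *)
Lemma decay_rate_eq i : k i = m / 2.
Proof.
suff h : m * (2 * k i - m) = 0.
  move: h => /eqP; rewrite mulf_eq0 gt_eqF//= subr_eq0 => /eqP <-; by field.
(* The four summands bound, in this order, the errors from [G i i x] in the linear term, from its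
   square, from the off-diagonal products, and from [u i x * u i x]. *)
apply: (@eq0_of_small R _ (2 * k i + (2 * m + 1) + N%:R + 1)) => e e0 e1.
have [x ux] := uG_y e e0.
have ui := (ux i i).1; have Gii := (ux i i).2; rewrite eqxx mulr1n in Gii.
have := ric i i x; rewrite (bigD1 i)//= => Rx.
have S : `|\sum_(l < N | l != i) G i l x * G l i x| <= N%:R * e.
  apply: (le_trans (ler_norm_sum _ _ _)).
  apply: (@le_trans _ _ (\sum_(l < N | l != i) e)).
    apply: ler_sum => l li.
    have := (ux i l).2; rewrite eq_sym (negbTE li) mulr0n subr0 => Gl.
    by rewrite (Gsym l i) normrM -[leRHS]mulr1 ler_pM// (le_trans Gl).
  rewrite mulr_natl -[X in _ *+ X](card_ord N) -sumr_const big_mkcond ler_sum//= => l _.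
  by case: ifP => // _; exact: ltW.
have U : `|u i x * u i x| <= e.
  by rewrite normrM -[leRHS]mulr1 ler_pM// (le_trans ui).
have Q : `|G i i x * G i i x - m * m| <= (2 * m + 1) * e.
  rewrite -!expr2 subr_sqr normrM mulrC ler_pM//.
  rewrite (_ : _ + _ = (G i i x - m) + 2 * m); last by ring.
  rewrite (le_trans (ler_normD _ _))// addrC lerD ?(le_trans Gii)//.
  by rewrite ger0_norm// mulr_ge0// ltW.
have K : `|(k i + k i) * (G i i x - m)| <= 2 * k i * e.
  rewrite normrM gtr0_norm; last by rewrite addr_gt0.
  by rewrite -mulr2n mulr_natl ler_wpM2l// mulrn_wge0// ltW.
rewrite !mulrDl mul1r; rewrite !mulrDl in Q.
move: K Q U S Rx; rewrite !ler_norml.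
set s := \sum_(_ < N | _) _ => K Q U S Rx; apply/andP; split; lra.
Qed.

(** The same combination of entries of [G] has zero derivative, hence is constant. It tends to 0 at
    -oo and to the left-hand side of the conclusion at +oo; this is the integral of the relation
    over the line. *)
Lemma gram_linear_relation (a b : R) i0 i1 i2 i3 :
  (forall x, a * (u i0 x * u i1 x) + b * (u i2 x * u i3 x) = 0) ->
  a * (m *+ (i0 == i1)) + b * (m *+ (i2 == i3)) = 0.
Proof.
move=> h.
have dP (x : R) : is_derive x 1 (fun y => a * G i0 i1 y + b * G i2 i3 y) 0.
  rewrite -(h x); apply: is_derive1D.
apply: (@eq0_of_small R _ (2 * (`|a| + `|b|))) => e e0 e1.
have [X GX] := G_Ny e e0; have [x Gx] := uG_y e e0.
have E := @is_derive_0_is_cst R _ x X dP; rewrite /= in E.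
have {}GX i j : `|G i j X| <= e by exact: GX.
have {}Gx i j : `|G i j x - m *+ (i == j)| <= e by case: (Gx i j).
rewrite (_ : _ + _ = (a * G i0 i1 X + b * G i2 i3 X) -
  (a * (G i0 i1 x - m *+ (i0 == i1)) + b * (G i2 i3 x - m *+ (i2 == i3)))); last first.
  by rewrite -E; ring.
have ab (s t : R) : `|s| <= e -> `|t| <= e -> `|a * s + b * t| <= (`|a| + `|b|) * e.
  by move=> se te; rewrite (le_trans (ler_normD _ _))// mulrDl !normrM lerD// ler_wpM2l.
by rewrite (le_trans (ler_normB _ _))// -mulrA mulr_natl mulr2n lerD// ab.
Qed.

(** With equal rates, [u i0] and [u i1] solve the same linear second-order equation. A combination
    [w] of them has zero Cauchy data at [x0], so it vanishes identically; integrating [w * u i1]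
    then gives [u i0 x0 * m = 0], although both factors are nonzero. *)
Lemma no_regular_solution : (1 < N)%N -> False.
Proof.
move=> N1; pose i0 : 'I_N := Ordinal (ltnW N1); pose i1 : 'I_N := Ordinal N1.
have i01 : (i0 == i1) = false by [].
have [B GB] := G_bounded.
(* The diagonal Riccati identity gives $u_i^2=mG_{ii}-\sum_lG_{il}^2\le mG_{ii}$. This bounds the
   coefficient [q] of the linear equation below. *)
have u_bnd i x : u i x ^+ 2 <= m * B.
  have := ric i i x; rewrite !decay_rate_eq => h.
  have : 0 <= \sum_l G i l x * G l i x.
    by apply: sumr_ge0 => l _; rewrite (Gsym l) -expr2 sqr_ge0.
  rewrite expr2 -h => S; have := GB i i x; rewrite ler_norml => /andP[_ g].
  have := ler_wpM2l (ltW m_gt0) g; lra.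
(* If [u i0] vanished identically, the trivial relation on its square would force [m = 0]. *)
have [x0 ux0] : exists x0, u i0 x0 != 0.
  apply: contrapT => /forallNP h.
  have := @gram_linear_relation 1 0 i0 i0 i0 i0; rewrite eqxx mulr1n mul1r mul0r addr0.
  move=> /(_ _)/eqP; rewrite gt_eqF// => H; suff : false by [].
  by apply: H => x; have /negP/negPn/eqP -> := h x; rewrite !mulr0 addr0.
have W0 x : u i0 x * v i1 x - u i1 x * v i0 x = 0.
  have dW (y : R) : is_derive y 1 (fun z => u i0 z * v i1 z - u i1 z * v i0 z) 0.
    have h : is_derive y 1 (fun z => u i0 z * v i1 z - u i1 z * v i0 z)
      ((v i0 y * v i1 y + u i0 y * (- (2 * (\sum_j u j y ^+ 2)) * u i1 y + k i1 ^+ 2 * u i1 y))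
       - (v i1 y * v i0 y + u i1 y * (- (2 * (\sum_j u j y ^+ 2)) * u i0 y + k i0 ^+ 2 * u i0 y))).
      apply: is_derive1D; first exact: is_derive1M.
      by apply: is_derive1N; exact: is_derive1M.
    by apply: is_derive_eq h _; rewrite !decay_rate_eq; ring.
  apply: (@eq0_of_small R _ 2) => e e0 e1.
  have [y _ uvy] := uv_Ny e 0 e0.
  have -> := @is_derive_0_is_cst R _ x y dW.
  have := uvy i0; have := uvy i1 => -[a b] [c d].
  have h (s t : R) : `|s| <= e -> `|t| <= e -> `|s * t| <= e.
    by move=> se te; rewrite normrM -[leRHS]mulr1 ler_pM// (le_trans te).
  by rewrite (le_trans (ler_normB _ _))// mulr_natl mulr2n lerD// h.
(* The coefficients make [w x0 = 0], while [w' x0] is the Wronskian at [x0], which is zero. *)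
pose w x := u i0 x0 * u i1 x - u i1 x0 * u i0 x.
pose w' x := u i0 x0 * v i1 x - u i1 x0 * v i0 x.
have dw (x : R) : is_derive x 1 w (w' x).
  rewrite /w; apply: is_derive1D.
pose q x := - (2 * (\sum_j u j x ^+ 2)) + (m / 2) ^+ 2.
have dw' (x : R) : is_derive x 1 w' (q x * w x).
  have h : is_derive x 1 w'
     (u i0 x0 * (- (2 * (\sum_j u j x ^+ 2)) * u i1 x + k i1 ^+ 2 * u i1 x) -
      (u i1 x0 * (- (2 * (\sum_j u j x ^+ 2)) * u i0 x + k i0 ^+ 2 * u i0 x))).
    rewrite /w'; apply: is_derive1D.
  by apply: is_derive_eq h _; rewrite !decay_rate_eq /q /w; ring.
pose C := 1 + 2 * (N%:R * (m * B)) + (m / 2) ^+ 2.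
have qC x : `|1 + q x| <= C.
  have S0 : 0 <= \sum_j u j x ^+ 2 by apply: sumr_ge0 => j _; exact: sqr_ge0.
  have S1 : \sum_j u j x ^+ 2 <= N%:R * (m * B).
    by rewrite mulr_natl -[X in _ *+ X](card_ord N) -sumr_const ler_sum.
  have M0 : 0 <= (m / 2) ^+ 2 by exact: sqr_ge0.
  rewrite ler_norml /q /C; move: S0 S1 M0; set S := \sum_j _; set M := (m / 2) ^+ 2.
  by move=> *; apply/andP; split; lra.
have E0 x : w x ^+ 2 + w' x ^+ 2 = 0.
  have dE (y : R) : is_derive y 1 (fun z => w z ^+ 2 + w' z ^+ 2)
      (2 * (w y * w' y) * (1 + q y)).
    have h : is_derive y 1 (fun z => w z * w z + w' z * w' z)
      ((w' y * w y + w y * w' y) + (q y * w y * w' y + w' y * (q y * w y))).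
      by apply: is_derive1D; exact: is_derive1M.
    by apply: is_derive_eq h _; ring.
  apply: (@gronwall_eq0 R _ _ C x0 dE) => [y|y|].
  - by rewrite addr_ge0 ?sqr_ge0.
  - rewrite normrM mulrC ler_pM//.
    rewrite ler_norml; have := sqr_ge0 (w y - w' y); have := sqr_ge0 (w y + w' y).
    by rewrite !expr2 => h1 h2; apply/andP; split; nra.
  - have -> : w x0 = 0 by rewrite /w; ring.
    have -> : w' x0 = 0 by exact: W0.
    by rewrite expr0n addr0.
have w0 x : w x = 0.
  apply/eqP; rewrite -sqrf_eq0; apply/eqP.
  by have := E0 x; have := sqr_ge0 (w x); have := sqr_ge0 (w' x); lra.
have := @gram_linear_relation (u i0 x0) (- u i1 x0) i1 i1 i0 i1.
rewrite eqxx i01 mulr1n mulr0n mulr0 addr0 => /(_ _)/eqP.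
rewrite mulf_eq0 (negbTE ux0) gt_eqF//= => H.
suff : false by [].
apply: H => x; transitivity (w x * u i1 x); last by rewrite w0 mul0r.
by rewrite /w; ring.
Qed.

End NoRegularSolution.

(** * Smooth steps *)

Section SmoothStep.
Context {R : realType}.

(** For [p = 1] this is the classical flat function $e^{-1/x}$; the polynomial factor in $1/x$ makes
    the family stable under differentiation. *)
Definition flat (p : {poly R}) (x : R) : R :=
  if 0 < x then p.[x^-1] * expR (- x^-1) else 0.

(* Closed under differentiation by construction, hence made of smooth
   functions. *)
Inductive flat_algebra : (R -> R) -> Prop :=
| flat_algebra_flat p : flat_algebra (flat p)
| flat_algebra_cst c : flat_algebra (fun=> c)
| flat_algebraD f g : flat_algebra f -> flat_algebra g ->
    flat_algebra (fun x => f x + g x)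
| flat_algebraM f g : flat_algebra f -> flat_algebra g ->
    flat_algebra (fun x => f x * g x)
| flat_algebraV f : flat_algebra f -> (forall x, f x != 0) ->
    flat_algebra (fun x => (f x)^-1)
| flat_algebra_affine f a b : flat_algebra f ->
    flat_algebra (fun x => f (a * x + b)).

(** Monomial by monomial, from $y^i/i!\le e^y$ for $y\ge0$. *)
Lemma horner_expRN_bounded (p : {poly R}) :
  exists2 C, 0 <= C & forall y, 0 <= y -> `|p.[y] * expR (- y)| <= C.
Proof.
exists (\sum_(i < size p) `|p`_i| * i`!%:R); first by apply: sumr_ge0 => i _; rewrite mulr_ge0.
move=> y y0; rewrite horner_coef mulr_suml (le_trans (ler_norm_sum _ _ _))//.
apply: ler_sum => i _; rewrite -mulrA normrM ler_wpM2l//.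
rewrite ger0_norm ?mulr_ge0 ?exprn_ge0 ?expR_ge0// expRN ler_pdivrMr ?expR_gt0//.
case: (val i) => [|n]; first by rewrite expr0 fact0 mul1r -expR0 ler_expR.
have := expR_ge1Dxn n y0 => h.
rewrite mulrC -ler_pdivrMr ?ltr0n ?fact_gt0//; lra.
Qed.

(** The previous bound for ['X^2 * p] at $y=1/h$. It yields the zero derivative at the origin. *)
Lemma flat_quadratic_bound (p : {poly R}) :
  exists2 C, 0 <= C & forall h, `|flat p h| <= C * h ^+ 2.
Proof.
have [C C0 pC] := horner_expRN_bounded ('X^2 * p).
exists C => // h; rewrite /flat; case: ltP => h0; last first.
  by rewrite normr0 mulr_ge0 ?sqr_ge0.
have := pC h^-1; rewrite invr_ge0 (ltW h0) => /(_ isT).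
rewrite hornerM hornerXn -mulrA normrM exprVn gtr0_norm ?invr_gt0 ?exprn_gt0//.
by rewrite mulrC ler_pdivrMr ?exprn_gt0.
Qed.

(** In the variable $y=1/x$ one has $(pe^{-y})'=-(p-p')e^{-y}$ and $dy/dx=-y^2$, whence the factor
    ['X^2]. At 0 the difference quotient is bounded by a multiple of $|h|$. *)
Lemma is_derive_flat (p : {poly R}) (x : R) :
  is_derive x 1 (flat p) (flat ('X^2 * (p - p^`())) x).
Proof.
case: (ltgtP x 0) => x0.
- have E : {near x, cst 0 =1 flat p}.
    near=> y; rewrite /flat ltNge ltW//=.
    by near: y; exact: lt_nbhsl.
  rewrite {2}/flat ltNge (ltW x0)/=.
  by apply: (@near_eq_is_derive R _ _ (cst 0)) => //; exact: is_derive_cst.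
- have E : {near x, (fun y => p.[y^-1] * expR (- y^-1)) =1 flat p}.
    near=> y; rewrite /flat ifT//.
    by near: y; exact: lt_nbhsr.
  apply: (@near_eq_is_derive R _ _ _ _ _ _ _ E).
  have dV : is_derive x 1 (fun y : R => y^-1) (- x ^- 2).
    have := @is_deriveV R id x 1 1; rewrite gt_eqF// => /(_ isT (is_derive_id _ _)).
    by rewrite /GRing.scale/= mulr1.
  have dp := is_derive1_comp (is_derive_poly p x^-1) dV.
  have de := @is_derive1_comp R expR (fun y => - y^-1) x _ _
    (is_derive_expR (- x^-1)) (is_derive1N _ _ _ dV).
  have h := is_derive1M _ _ _ _ _ dp de.
  apply: is_derive_eq h _.
  by rewrite /flat x0 !hornerE /= exprVn; ring.
- rewrite x0 {2}/flat ltxx.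
  have [C C0 pC] := flat_quadratic_bound p.
  have L : h^-1 *: ((flat p \o shift 0) (h *: 1) - flat p 0) @[h --> (0:R)^'] --> (0 : R).
    apply/cvgrPdist_le => /= e e0; near=> h.
    have h0 : h != 0 by near: h; exact: nbhs_dnbhs_neq.
    rewrite sub0r normrN /flat ltxx subr0 addr0 -/(flat p _).
    rewrite /GRing.scale/= mulr1 normrM normfV.
    rewrite ler_pdivrMl ?normr_gt0// (le_trans (pC h))//.
    rewrite -(real_normK (num_real h)) expr2 mulrA mulrC ler_wpM2l//.
    have : `|h| < e / (C + 1).
      near: h; apply: dnbhs0_lt; rewrite divr_gt0// ltr_wpDl//.
    rewrite ltr_pdivlMr ?ltr_wpDl// => hC.
    by have := normr_ge0 h; nra.
  apply: DeriveDef; last exact: cvg_lim L.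
  by apply/cvg_ex; exists 0.
Unshelve. all: by end_near. Qed.

Lemma flat_algebra_derive f : flat_algebra f ->
  exists2 g, flat_algebra g & forall x : R, is_derive x 1 f (g x).
Proof.
elim=> {f}.
- move=> p; exists (flat ('X^2 * (p - p^`()))); first exact: flat_algebra_flat.
  exact: is_derive_flat.
- by move=> c; exists (fun=> 0); [exact: flat_algebra_cst|move=> x; exact: is_derive_cst].
- move=> f1 f2 _ [g1 a1 d1] _ [g2 a2 d2]; exists (fun x => g1 x + g2 x).
    exact: flat_algebraD.
  by move=> x; exact: is_derive1D.
- move=> f1 f2 a1 [g1 b1 d1] a2 [g2 b2 d2].
  exists (fun x => g1 x * f2 x + f1 x * g2 x).
    by apply: flat_algebraD; exact: flat_algebraM.
  by move=> x; exact: is_derive1M.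
- move=> f a [g b d] f0; exists (fun x => (-1 * ((f x)^-1 * (f x)^-1)) * g x).
    apply: flat_algebraM => //; apply: (flat_algebraM (fun=> -1)).
      exact: flat_algebra_cst.
    by apply: flat_algebraM; exact: flat_algebraV.
  move=> x; have h := is_deriveV (f0 x) (d x).
  by apply: is_derive_eq h _; rewrite /GRing.scale/= mulN1r expr2 invfM.
- move=> f a b fa [g ga d]; exists (fun x => a * g (a * x + b)).
    by apply: (flat_algebraM (fun=> a)); [exact: flat_algebra_cst|exact: flat_algebra_affine].
  move=> x.
  have h : is_derive x 1 (fun y => a * y + b) (a * 1 + 0).
    apply: is_derive1D.
  have := @is_derive1_comp R f (fun y => a * y + b) x _ _ (d (a * x + b)) h.
  by rewrite mulr1 addr0 mulrC.
Qed.

Lemma flat_algebra_derive1 f : flat_algebra f -> flat_algebra (derive1 f).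
Proof.
move=> /flat_algebra_derive[g ga d].
suff -> : derive1 f = g by [].
by apply/funext => x; rewrite derive1E derive_val.
Qed.

Lemma flat_algebra_is_derive f (x : R) : flat_algebra f -> is_derive x 1 f (derive1 f x).
Proof.
move=> /flat_algebra_derive[g ga d].
by rewrite derive1E; apply: derivableP; case: (d x).
Qed.

Lemma flat_algebra_continuous f : flat_algebra f -> continuous f.
Proof.
move=> fa x; apply/differentiable_continuous/derivable1_diffP.
by case: (flat_algebra_is_derive f x fa).
Qed.

Lemma flat_algebra_test_function f a b : flat_algebra f ->
  (forall x, f x != 0 -> a <= x <= b) -> test_function f.
Proof.
move=> fa fab; split.
  have h n : flat_algebra (derive1n n f).
    by elim: n => [|n ih]; [exact: fa|rewrite derive1nS; exact: flat_algebra_derive1].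
  by move=> n x; case: (flat_algebra_is_derive _ x (h n)).
apply: (@subclosed_compact _ _ `[a, b]%classic); first exact: closed_closure.
  exact: segment_compact.
rewrite [X in _ `<=` X](closure_id _).1; last exact: itv_closed.
by apply: closure_subset => x /= /fab; rewrite in_itv.
Qed.

Lemma smooth_step : exists H : R -> R, [/\ flat_algebra H,
  forall x, x <= 0 -> H x = 0, forall x, 1 <= x -> H x = 1 &
  forall x, 0 <= H x <= 1].
Proof.
have e_ge0 x : 0 <= flat 1 x.
  by rewrite /flat; case: ifP => // _; rewrite hornerE mul1r expR_ge0.
have e_gt0 x : 0 < x -> 0 < flat 1 x.
  by rewrite /flat => ->; rewrite hornerE mul1r expR_gt0.
have e_eq0 x : x <= 0 -> flat 1 x = 0 by rewrite /flat ltNge => ->.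
have den_gt0 x : 0 < flat 1 x + flat 1 (-1 * x + 1).
  case: (ltP 0 x) => x0; first by rewrite ltr_pwDl// e_gt0.
  by rewrite ltr_wpDl// e_gt0//; lra.
(* The denominator is positive because [x] and [1 - x] are never both nonpositive. *)
exists (fun x => flat 1 x * (flat 1 x + flat 1 (-1 * x + 1))^-1); split.
- apply: flat_algebraM; first exact: flat_algebra_flat.
  apply: flat_algebraV; last by move=> x; rewrite gt_eqF.
  apply: flat_algebraD; first exact: flat_algebra_flat.
  by apply: flat_algebra_affine; exact: flat_algebra_flat.
- by move=> x x0; rewrite e_eq0// mul0r.
- move=> x x1; rewrite [flat _ (_ + _)]e_eq0; last by lra.
  by rewrite addr0 divff// gt_eqF// e_gt0//; lra.
- move=> x; rewrite divr_ge0 ?(ltW (den_gt0 _))//=.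
  by rewrite ler_pdivrMr// mul1r lerDl.
Qed.

End SmoothStep.

(** * Weak derivatives *)

Lemma dominated_cvg_Rintegral d (T : measurableType d)
  (R : realType) (mu : {measure set T -> \bar R}) (D : set T)
  (f_ : nat -> T -> R) (f g : T -> R) :
  measurable D -> (forall n, measurable_fun D (f_ n)) -> measurable_fun D f ->
  (forall x, D x -> f_ n x @[n --> \oo] --> f x) ->
  mu.-integrable D (EFin \o g) -> (forall n x, D x -> `|f_ n x| <= g x) ->
  \int[mu]_(x in D) f_ n x @[n --> \oo] --> \int[mu]_(x in D) f x.
Proof.
move=> mD mf_ mf f_f ig fg.
have [||||i _ L] := @dominated_convergence _ _ R mu D mD (fun n => EFin \o f_ n)
  (EFin \o f) (EFin \o g) _ _ _ ig.
- by move=> n /=; apply/measurable_EFinP; exact: mf_.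
- by apply/measurable_EFinP.
- by apply: aeW => x Dx; apply: cvg_EFin; [exact: nearW|exact: f_f].
- by apply: aeW => x n Dx; rewrite /= lee_fin fg.
have := integrable_fin_num mD i => fi.
rewrite -(fineK fi) in L.
exact: fine_cvg L.
Qed.

Section Integration.
Context {R : realType}.
Notation mu := (@lebesgue_measure R).

Lemma integrable_mul_bounded (f g : R -> R) (c d M : R) :
  locally_integrable setT f -> measurable_fun setT g ->
  (forall x, `|g x| <= M) -> (forall x, g x != 0 -> c <= x <= d) ->
  mu.-integrable setT (EFin \o (fun x => f x * g x)).
Proof.
move=> [mf _ lf] mg gM gcd.
have icd : mu.-integrable `[c, d] (EFin \o f).
  apply/integrableP; split.
    by apply/measurable_EFinP; apply: measurable_funS mf.
  by apply: lf => //; exact: segment_compact.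
have {}icd : mu.-integrable setT (EFin \o (f \_ `[c, d])).
  rewrite -restrict_EFin.
  exact: (@integrable_mkcond _ _ _ mu `[c, d]%classic (EFin \o f) (measurable_itv _)).1.
have iM := integrableZl measurableT M icd.
apply: le_integrable iM => //.
  by apply/measurable_EFinP; exact: measurable_funM.
move=> x _; rewrite /= lee_fin !normrM mulrC.
have [g0|gn0] := eqVneq (g x) 0; first by rewrite g0 normr0 mul0r mulr_ge0.
rewrite patchE mem_set/=; last by rewrite in_itv/= gcd.
by rewrite ler_wpM2r// (le_trans (gM x))// ler_norm.
Qed.

Lemma locally_integrable_itv (f : R -> R) (c d : R) :
  locally_integrable setT f -> mu.-integrable `[c, d] (EFin \o f).
Proof.
move=> [mf _ lf]; apply/integrableP; split.
  by apply/measurable_EFinP; apply: measurable_funS mf.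
by apply: lf => //; exact: segment_compact.
Qed.

End Integration.

(** * Derivatives of steep steps as an approximate identity *)

Section Mollifier.
Context {R : realType}.
Notation mu := (@lebesgue_measure R).
Variable H : R -> R.
Hypothesis aH : flat_algebra H.
Hypothesis step_le0 : forall x, x <= 0 -> H x = 0.
Hypothesis step_ge1 : forall x, 1 <= x -> H x = 1.

(** The rise from 0 to 1 takes place on [[a, a + n.+1%:R^-1]], to the right of [a]; the derivative
    is a one-sided mollifier at [a]. *)
Definition steep_step (n : nat) (a x : R) : R := H (n.+1%:R * x + - (n.+1%:R * a)).

Local Notation S := steep_step.

Lemma flat_algebra_steep_step n a : flat_algebra (S n a).
Proof. exact: flat_algebra_affine. Qed.

Lemma steep_step_le n a x : x <= a -> S n a x = 0.
Proof. by move=> xa; rewrite /S step_le0// -mulrBr pmulr_rle0// subr_le0. Qed.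

Lemma steep_step_ge n a x : a + n.+1%:R^-1 <= x -> S n a x = 1.
Proof.
by move=> ax; rewrite /S step_ge1// -mulrBr -ler_pdivrMl// mulr1 lerBrDl.
Qed.

Lemma invSn_le1 n : n.+1%:R^-1 <= 1 :> R.
Proof. by rewrite invf_le1// ler1n. Qed.

Lemma derive1_steep_step_supp n a x :
  derive1 (S n a) x != 0 -> a <= x <= a + n.+1%:R^-1.
Proof.
apply: contraNT; rewrite negb_and -!ltNge => /orP[xa|ax].
- have E : {near x, cst 0 =1 S n a}.
    near=> y; rewrite steep_step_le//.
    by apply: ltW; near: y; exact: lt_nbhsl.
  by rewrite derive1E -(near_eq_derive _ E) derive_cst.
- have E : {near x, cst 1 =1 S n a}.
    near=> y; rewrite steep_step_ge//.
    by apply: ltW; near: y; exact: lt_nbhsr.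
  by rewrite derive1E -(near_eq_derive _ E) derive_cst.
Unshelve. all: by end_near. Qed.

Lemma derive1_steep_step n a x :
  derive1 (S n a) x = n.+1%:R * derive1 H (n.+1%:R * x + - (n.+1%:R * a)).
Proof.
have h : is_derive x 1 (fun y : R => n.+1%:R * y + - (n.+1%:R * a)) (n.+1%:R * 1 + 0).
  apply: is_derive1D.
have [_ hE] := @is_derive1_comp R H _ x _ _ (flat_algebra_is_derive _ _ aH) h.
by rewrite [LHS]derive1E [LHS]hE mulr1 addr0 mulrC.
Qed.

Lemma derive1_steep_step_bounded :
  exists2 M, 0 <= M & forall n a x, `|derive1 (S n a) x| <= n.+1%:R * M.
Proof.
have cH : continuous (fun x => `|derive1 H x|).
  move=> x; apply: cvg_norm.
  by apply: flat_algebra_continuous; exact: flat_algebra_derive1.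
have I01 : (`[0, 1]%classic : set R) !=set0.
  by exists 0; rewrite /= in_itv/= lexx ler01.
have [c _ cM] := @compact_EVT_max _ R (fun x => `|derive1 H x|) `[0, 1]%classic
   I01 (@segment_compact _ 0 1) (continuous_subspaceT cH).
exists `|derive1 H c| => // n a x; rewrite derive1_steep_step normrM.
rewrite ger0_norm// ler_wpM2l//.
set y := _ + _.
have [->|y0] := eqVneq (derive1 H y) 0; first by rewrite normr0.
apply: cM; rewrite inE/= in_itv/=.
(* [H] is itself the steep step with [n = 0] and [a = 0], so its derivative is supported in
   [0, 1]. *)
have := derive1_steep_step_supp 0 0 y; rewrite derive1_steep_step.
by rewrite mulr0 oppr0 addr0 mul1r invr1 add0r mul1r; apply.
Qed.

Lemma measurable_flat_algebra f : flat_algebra f -> measurable_fun [set: R] f.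
Proof. by move=> fa; apply: continuous_measurable_fun; exact: flat_algebra_continuous. Qed.

Lemma Rintegral_derive1_steep_step n a : \int[mu]_x derive1 (S n a) x = 1.
Proof.
have aS := flat_algebra_steep_step n a.
have -> : \int[mu]_x derive1 (S n a) x = \int[mu]_(x in `[a, a + 1]) derive1 (S n a) x.
  rewrite [RHS]Rintegral_mkcond; congr (Rintegral _ _ _); apply/funext => x.
  rewrite patchE; case: ifPn => //; rewrite notin_setE/= in_itv/= => /negP.
  apply: contraNeq => /derive1_steep_step_supp /andP[-> h] /=.
  by rewrite (le_trans h)// lerD2l invSn_le1.
rewrite /Rintegral (@continuous_FTC2 _ _ (S n a)).
- by rewrite -EFinB/= steep_step_ge ?steep_step_le ?subr0// lerD2l invSn_le1.
- by rewrite ltrDl.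
- by apply/continuous_subspaceT/flat_algebra_continuous; exact: flat_algebra_derive1.
- split.
  + by move=> x _; case: (flat_algebra_is_derive _ x aS).
  + by apply: cvg_at_right_filter; exact: flat_algebra_continuous.
  + by apply: cvg_at_left_filter; exact: flat_algebra_continuous.
- by [].
Qed.

Lemma integrable_derive1_steep_step f n a : locally_integrable setT f ->
  mu.-integrable setT (EFin \o (fun x => f x * derive1 (S n a) x)).
Proof.
move=> lf; have [M M0 SM] := derive1_steep_step_bounded.
apply: (@integrable_mul_bounded _ _ _ _ _ _ lf _ (SM n a) (derive1_steep_step_supp n a)).
by apply: measurable_flat_algebra; apply: flat_algebra_derive1; exact: flat_algebra_steep_step.
Qed.

Lemma locally_integrable_cst (c : R) : locally_integrable setT (fun=> c : R).
Proof.
split => //; first exact: openT.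
move=> K _ cK; rewrite integral_cst//=; last exact: compact_measurable.
by rewrite lte_mul_pinfty// ?lee_fin//; exact: compact_finite_measure.
Qed.

(** The kernel has integral 1, height at most [n.+1%:R * M] and support in a ball of radius [r n],
    so the error is at most a constant times the mean of [|f - f a|] over that ball. This mean tends
    to 0 at a Lebesgue point. *)
Lemma mollifier_lebesgue_pt f a : locally_integrable setT f -> lebesgue_pt f a ->
  \int[mu]_x (f x * derive1 (S n a) x) @[n --> \oo] --> f a.
Proof.
move=> lf fa; have [M M0 SM] := derive1_steep_step_bounded.
(* The factor 2 puts the closed support of the kernel inside the open ball. The ball has measure
   [4 / n.+1%:R], which explains the constant [4 * M]. *)
pose r n : R := 2 / n.+1%:R.
have r0 n : 0 < r n by rewrite divr_gt0.
have bound n : (`|\int[mu]_x (f x * derive1 (S n a) x) - f a|%:E <=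
    (4 * M)%:E * davg f a (r n))%E.
  have iS := integrable_derive1_steep_step f n a lf.
  have ic := integrable_derive1_steep_step _ n a (locally_integrable_cst (f a)).
  have -> : f a = \int[mu]_x (f a * derive1 (S n a) x).
    rewrite RintegralZl// ?Rintegral_derive1_steep_step ?mulr1//.
    have := integrable_derive1_steep_step _ n a (locally_integrable_cst 1).
    by under eq_fun do rewrite mul1r.
  rewrite -RintegralB//.
  have iB := integrableB measurableT iS ic.
  rewrite EFin_normr_Rintegral//.
  apply: le_trans (le_abse_integral _ _ _) _ => //; first by case/integrableP: iB.
  have mball : measurable (ball a (r n)) by exact: measurable_ball.
  have mf : measurable_fun setT (fun x => (`|f x - f a|)%:E).
    apply/measurable_EFinP; apply: measurableT_comp => //.
    by apply: measurable_funB => //; case: lf.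
  have mfb : measurable_fun (ball a (r n)) (fun x => (`|f x - f a|)%:E).
    exact: measurable_funS mf.
  have -> : ((4 * M)%:E * davg f a (r n) =
     \int[mu]_(x in ball a (r n)) ((n.+1%:R * M)%:E * (`|f x - f a|)%:E))%E.
    rewrite ge0_integralZl//; last by rewrite lee_fin mulr_ge0.
    rewrite /davg /iavg lebesgue_measure_ball ?ltW// muleA; congr (_ * _)%E.
    rewrite inver gt_eqF ?mulrn_wgt0// -EFinM; congr (_%:E).
    by rewrite /r -mulr_natl; field.
  rewrite [leRHS]integral_mkcond; apply: ge0_le_integral => //.
  - by apply: measurableT_comp => //; case/integrableP: iB.
  - apply/(measurable_restrictT _ _).1 => //.
    exact: measurable_funeM.
  - move=> x _; rewrite patchE /= -mulrBl normrM.
    case: ifPn => [_|].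
      by rewrite -EFinM lee_fin mulrC ler_wpM2r.
    rewrite notin_setE /ball/= => xa.
    suff -> : derive1 (S n a) x = 0 by rewrite normr0 mulr0.
    apply: contra_notP xa => /eqP/derive1_steep_step_supp/andP[ax xa].
    rewrite ler0_norm ?subr_le0// opprB ltrBlDl (le_lt_trans xa)// ltrD2l /r.
    by rewrite ltr_pMl ?invr_gt0// ltr1n.
have L : ((4 * M)%:E * davg f a (r n))%E @[n --> \oo] --> 0%E.
  rewrite -[X in _ --> X](mule0 (4 * M)%:E); apply: cvgeZl => //.
  have r_0 : r n @[n --> \oo] --> 0.
    rewrite -(mulr0 2); apply: cvgM; [exact: cvg_cst|exact: cvg_harmonic].
  apply: (cvg_comp r (davg f a) _ fa) => A A0.
  have : (\forall n \near \oo, 0 < r n -> A (r n)) by exact: r_0 _ A0.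
  by apply: filterS => n; apply; exact: r0.
apply/subr_cvg0/norm_cvg0P.
have : (`|\int[mu]_x (f x * derive1 (S n a) x) - f a|%:E @[n --> \oo] --> 0)%E.
  apply: squeeze_cvge (cvg_cst 0%E) L.
  by apply: nearW => n; rewrite lee_fin normr_ge0 bound.
exact: fine_cvg.
Qed.

End Mollifier.

(** * Increments and primitives of weak derivatives *)

Section WeakDerivative.
Context {R : realType}.
Notation mu := (@lebesgue_measure R).

Lemma weak_derivative_increment (f h : R -> R) (a b : R) :
  locally_integrable setT f -> locally_integrable setT h ->
  (forall phi, test_function phi -> distr_deriv (distr_of f) phi = distr_of h phi) ->
  a < b -> lebesgue_pt f a -> lebesgue_pt f b ->
  f b - f a = \int[mu]_(x in `[a, b]) h x.
Proof.
move=> lf lh fh ab fa fb.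
have [H [aH H0 H1 H01]] := @smooth_step R.
pose S := steep_step H.
(* A smooth bump supported in [[a, b + 1]]. Its derivative is the difference of the mollifiers at
   [a] and [b]; the bump itself tends to the indicator of []a, b]], half-open since both steps rise
   to the right of their base points. *)
pose phi n x := S n a x + -1 * S n b x.
have aS n c : flat_algebra (S n c) by exact: flat_algebra_steep_step.
have aphi n : flat_algebra (phi n).
  apply: flat_algebraD => //; apply: flat_algebraM => //; exact: flat_algebra_cst.
have le0 n c x : x <= c -> S n c x = 0 by exact: steep_step_le.
have ge1 n c x : c + n.+1%:R^-1 <= x -> S n c x = 1 by exact: steep_step_ge.
have S01 n c x : 0 <= S n c x <= 1 by exact: H01.
have phi_supp n x : phi n x != 0 -> a <= x <= b + 1.
  apply: contraNT; rewrite negb_and -!ltNge => /orP[xa|bx]; rewrite /phi.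
    by rewrite !le0 ?mulr0 ?addr0//; lra.
  have n1 := @invSn_le1 R n.
  by rewrite !ge1 ?mulN1r ?subrr//; move: n1; set t := _^-1 => n1; lra.
have phi_bnd n x : `|phi n x| <= 1.
  rewrite /phi ler_norml; have /andP[? ?] := S01 n a x.
  by have /andP[? ?] := S01 n b x; apply/andP; split; lra.
have E n : \int[mu]_x (f x * derive1 (S n b) x) - \int[mu]_x (f x * derive1 (S n a) x) =
    \int[mu]_x (h x * phi n x).
  have := fh _ (flat_algebra_test_function _ _ _ (aphi n) (phi_supp n)).
  rewrite /distr_deriv /distr_of => <-.
  have -> : (fun x => f x * derive1 (phi n) x) =
     (fun x => f x * derive1 (S n a) x - f x * derive1 (S n b) x).
    apply/funext => x; rewrite -mulrBr; congr (_ * _).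
    have da := flat_algebra_is_derive _ x (aS n a).
    have db := flat_algebra_is_derive _ x (aS n b).
    have [_ dE] := is_derive1D _ _ _ _ _ da (is_derive1Z (-1) _ _ _ db).
    by rewrite derive1E [LHS]dE mulN1r.
  by rewrite RintegralB ?opprB//; exact: integrable_derive1_steep_step.
have L1 : \int[mu]_x (h x * phi n x) @[n --> \oo] --> f b - f a.
  under eq_fun do rewrite -E.
  by apply: cvgB; exact: mollifier_lebesgue_pt.
have ih c d : mu.-integrable `[c, d] (EFin \o h) by exact: locally_integrable_itv.
have L2 : \int[mu]_x (h x * phi n x) @[n --> \oo] -->
    \int[mu]_x (h \_ `]a, b]) x.
  have mh : measurable_fun [set: R] h by case: lh.
  have ig : mu.-integrable setT (EFin \o ((fun x => `|h x|) \_ `[a, b + 1])).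
    rewrite -restrict_EFin.
    apply: (@integrable_mkcond _ _ _ mu `[a, b + 1]%classic _ (measurable_itv _)).1.
    exact: (integrable_norm (ih _ _)).
  apply: (dominated_cvg_Rintegral _ _ _ _ _ _ _ _ _ _ _ _ ig) => //.
  - by move=> n; apply: measurable_funM => //; exact: measurable_flat_algebra.
  - exact: (@measurable_restrictT _ _ _ _ `]a, b]%classic h (measurable_itv _)).1
      (measurable_funS measurableT (@subsetT _ _) mh).
  - move=> x _; apply: cvg_near_cst.
    have nearS c : c < x -> \forall n \near \oo, S n c x = 1.
      move=> cx; have xc : 0 < x - c by rewrite subr_gt0.
      have := near_infty_natSinv_lt (PosNum xc); apply: filterS => n /= nx.
      by rewrite ge1//; move: nx; set t := _^-1 => nx; lra.
    rewrite patchE mem_setE in_itv/=.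
    case: (leP x a) => xa /=.
      by apply: nearW => n; rewrite /phi !le0 ?mulr0 ?addr0 ?mulr0//; lra.
    case: (leP x b) => xb.
      apply: filterS (nearS _ xa) => n Sn.
      by rewrite /phi Sn le0// mulr0 addr0 mulr1.
    near=> n; rewrite /phi.
    have -> : S n a x = 1 by near: n; exact: nearS.
    have -> : S n b x = 1 by near: n; exact: nearS.
    by rewrite mulN1r subrr mulr0.
  - move=> n x _; rewrite patchE mem_setE in_itv/= normrM.
    case: ifPn => [_|h0]; first by rewrite ler_piMr.
    have [->|/phi_supp] := eqVneq (phi n x) 0; first by rewrite normr0 mulr0.
    by rewrite (negbTE h0).
rewrite (cvg_unique _ L1 L2)//.
rewrite -Rintegral_mkcond Rintegral_itv_obnd_cbnd//.
by apply: integrableS (ih a b) => //; exact: subset_itv_oc_cc.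
Unshelve. all: by end_near. Qed.

Lemma Rintegral_itv_cat (h : R -> R) (a b c : R) : locally_integrable setT h ->
  a <= b -> b <= c ->
  \int[mu]_(x in `[a, c]) h x =
  \int[mu]_(x in `[a, b]) h x + \int[mu]_(x in `[b, c]) h x.
Proof.
move=> lh ab bc; have ih u v := @locally_integrable_itv R h u v lh.
have := @Rintegral_itvB _ h (BLeft a) (BRight c) b (ih a c).
rewrite !bnd_simp => /(_ ab bc) E.
rewrite -(@Rintegral_itv_obnd_cbnd _ b).
  by rewrite -E; ring.
by apply: integrableS (ih b c) => //; exact: subset_itv_oc_cc.
Qed.

Lemma ae_exists (P : R -> Prop) : {ae mu, forall x, P x} -> exists x, P x.
Proof.
move=> aeP; apply: contrapT => /forallNP nP.
have : mu.-negligible [set: R].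
  by apply: negligibleS aeP => x _; exact: nP.
move=> /(measure_negligible measurableT) E.
by have := @lebesgue_measure_itv R `]-oo, +oo[; rewrite set_itvNyy [LHS]E.
Qed.

(** Almost every point is a Lebesgue point of [f]; with one of them as base point [x0], the
    increment formula determines [f] at all others. The case distinction supplies the sign of an
    oriented integral. *)
Lemma weak_derivative_primitive (f h : R -> R) :
  locally_integrable setT f -> locally_integrable setT h ->
  (forall phi, test_function phi -> distr_deriv (distr_of f) phi = distr_of h phi) ->
  exists2 F : R -> R, {ae mu, forall x, f x = F x} &
    forall a b, a <= b -> F b - F a = \int[mu]_(x in `[a, b]) h x.
Proof.
move=> lf lh fh; have aef := lebesgue_differentiation lf.
have [x0 fx0] := ae_exists _ aef.
pose I a b := \int[mu]_(x in `[a, b]) h x.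
have Icat a b c : a <= b -> b <= c -> I a c = I a b + I b c.
  exact: Rintegral_itv_cat.
exists (fun x => f x0 + (if x0 <= x then I x0 x else - I x x0)).
  move: aef; apply: filterS; first exact: (ae_filter_ringOfSetsType mu).
  move=> x fx.
  have inc := weak_derivative_increment _ _ _ _ lf lh fh.
  case: (ltgtP x0 x) => [xx|xx|<-].
  - by rewrite -[X in _ = _ + X]inc//; ring.
  - by rewrite -[X in _ = _ - X]inc//; ring.
  - by rewrite /I set_itv1 Rintegral_set1 addr0.
move=> a b ab; rewrite -/(I a b).
case: (leP x0 a) => a0; case: (leP x0 b) => b0.
- by rewrite (Icat x0 a b)//; ring.
- by have := le_lt_trans ab b0; rewrite ltNge a0.
- by rewrite (Icat a x0 b) ?(ltW a0)//; ring.
- by rewrite (Icat a b x0) ?(ltW b0)//; ring.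
Qed.

End WeakDerivative.

(** * Regularity of weak solutions *)

Section Primitive.
Context {R : realType}.
Notation mu := (@lebesgue_measure R).

Lemma continuous_locally_integrable (f : R -> R) : continuous f ->
  locally_integrable setT f.
Proof.
move=> cf; split; [exact: continuous_measurable_fun|exact: openT|].
move=> K _ cK; have := continuous_compact_integrable cK (continuous_subspaceT cf).
by case/integrableP.
Qed.

Lemma primitive_continuous (F h : R -> R) : locally_integrable setT h ->
  (forall a b, a <= b -> F b - F a = \int[mu]_(x in `[a, b]) h x) ->
  continuous F.
Proof.
move=> lh Fh x.
have xx : x - 1 < x + 1 by lra.
have := parameterized_integral_continuous (ltW xx) (locally_integrable_itv _ (x - 1) (x + 1) lh).
move=> /within_continuous_continuous => /(_ x); rewrite in_itv/=.
have -> : x - 1 < x < x + 1 by apply/andP; split; lra.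
move=> /(_ xx isT) cG.
have E : {near x, (fun y => F (x - 1) + parameterized_integral mu (x - 1) y h) =1 F}.
  near=> y; have : x - 1 <= y by apply: ltW; near: y; apply: lt_nbhsr; lra.
  by move=> /Fh; rewrite /parameterized_integral => <-; rewrite addrC subrK.
have Ex := nbhs_singleton E.
rewrite /continuous_at -Ex.
apply: cvg_trans (near_eq_cvg E) _.
by apply: cvgD; [exact: cvg_cst|exact: cG].
Unshelve. all: by end_near. Qed.

Lemma primitive_is_derive (F h : R -> R) : continuous h ->
  (forall a b, a <= b -> F b - F a = \int[mu]_(x in `[a, b]) h x) ->
  forall x : R, is_derive x 1 F (h x).
Proof.
move=> ch Fh x.
have lh := continuous_locally_integrable _ ch.
have := @continuous_FTC1_closed R h (x - 1) x (x + 1) _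
   (locally_integrable_itv _ (x - 1) (x + 1) lh) _ (ch x).
rewrite ltrDl ltr01 ltrBlDr ltrDl ltr01 => /(_ isT isT)[dG GE].
have dG' : is_derive x 1 (fun y => \int[mu]_(t in `[x - 1, y]) h t) (h x).
  by rewrite -GE derive1E; exact: derivableP.
have E : {near x, (fun y => F (x - 1) + \int[mu]_(t in `[x - 1, y]) h t) =1 F}.
  near=> y; have : x - 1 <= y by apply: ltW; near: y; apply: lt_nbhsr; lra.
  by move=> /Fh <-; rewrite addrC subrK.
apply: (@near_eq_is_derive R _ _ _ _ _ _ _ E).
have := is_derive1D _ _ _ _ _ (is_derive_cst (F (x - 1)) x (1:R)) dG'.
by rewrite add0r.
Unshelve. all: by end_near. Qed.

(** On a compact set $|f|\le1+f^2$, and both terms are integrable there. *)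
Lemma Lfun2_locally_integrable (f : R -> R) : f \in Lfun mu 2%:E ->
  locally_integrable setT f.
Proof.
move=> f2; have i2 := Lfun2_integrable_sqr f2.
have mf : measurable_fun setT f by move: f2; rewrite inE => /andP[/[!inE]].
split; [exact: mf|exact: openT|].
move=> K _ cK.
have mK : @measurable _ (measurableTypeR R) K by exact: compact_measurable.
have i1 : mu.-integrable K (EFin \o (fun=> 1 : R)).
  by apply: continuous_compact_integrable => // x; exact: cst_continuous.
have i2K : mu.-integrable K (EFin \o (fun x => f x ^+ 2)).
  exact: (@integrableS _ _ _ mu setT K).
have iD := integrableD mK i1 i2K.
have mfK : measurable_fun (K : set (measurableTypeR R)) (EFin \o f).
  by apply/measurable_EFinP; exact: measurable_funS mf.
have : mu.-integrable K (EFin \o f).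
  apply: (le_integrable mK mfK _ iD) => x _.
  rewrite /= lee_fin [leRHS]ger0_norm ?addr_ge0 ?sqr_ge0//.
  have := sqr_ge0 (`|f x| - 1); have := normr_ge0 (f x).
  by rewrite -[f x ^+ 2]real_normK ?num_real//; set t := `|f x| => ? ?; nra.
by case/integrableP.
Qed.

Lemma test_function_bounded (phi : R -> R) : test_function phi ->
  exists c d M, [/\ measurable_fun setT phi, forall x, `|phi x| <= M &
    forall x, phi x != 0 -> c <= x <= d].
Proof.
move=> [dphi cphi].
have cont : continuous phi.
  by move=> x; apply/differentiable_continuous/derivable1_diffP; exact: (dphi 0).
have [B [_ Bb]] := compact_bounded cphi.
pose c := `|B| + 1.
have supp x : phi x != 0 -> - c <= x <= c.
  move=> px; rewrite -ler_norml; apply: Bb; last exact: subset_closure.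
  by rewrite /c (le_lt_trans (ler_norm B))// ltrDl.
have c0 : - c <= c by rewrite /c; have := normr_ge0 B; lra.
have I0 : (`[- c, c]%classic : set R) !=set0 by exists c; rewrite /= in_itv/= lexx c0.
have cn : continuous (fun x => `|phi x|) by move=> x; apply: cvg_norm; exact: cont.
have [y _ yM] := @compact_EVT_max _ R (fun x => `|phi x|) _ I0
  (@segment_compact _ (- c) c) (continuous_subspaceT cn).
exists (- c), c, `|phi y|; split => //; first exact: continuous_measurable_fun.
move=> x; have [->|/supp h] := eqVneq (phi x) 0; first by rewrite normr0.
by apply: yM; rewrite inE/= in_itv.
Qed.

Lemma test_function_derive1 (phi : R -> R) : test_function phi ->
  test_function (derive1 phi).
Proof.
move=> [dphi cphi]; split.
  by move=> n x; have := dphi n.+1 x; rewrite /derive1n iterSr.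
apply: subclosed_compact cphi _; first exact: closed_closure.
rewrite [X in _ `<=` X](closure_id _).1; last exact: closed_closure.
apply: closure_subset => x /=; apply: contraNP => xc.
have : nbhs x (~` closure [set x | phi x != 0]).
  by apply: open_nbhs_nbhs; split => //; apply: closed_openC; exact: closed_closure.
move=> nx; apply/eqP.
have E : {near x, cst 0 =1 phi}.
  near=> y; apply/esym/eqP/negPn/negP => py.
  have : (~` closure [set x | phi x != 0]) y by near: y.
  by apply; exact: subset_closure.
by rewrite derive1E -(near_eq_derive _ E) derive_cst.
Unshelve. all: by end_near. Qed.

Lemma integrable_mul_test_function (f phi : R -> R) :
  locally_integrable setT f -> test_function phi ->
  mu.-integrable setT (EFin \o (fun x => f x * phi x)).
Proof.
move=> lf /test_function_bounded[c [d [M [mphi pM pcd]]]].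
exact: integrable_mul_bounded lf mphi pM pcd.
Qed.

Lemma ae_eq_Rintegral (D : set (measurableTypeR R)) (f g : R -> R) : measurable D ->
  measurable_fun D f -> measurable_fun D g ->
  {ae mu, forall x, f x = g x} ->
  \int[mu]_(x in D) f x = \int[mu]_(x in D) g x.
Proof.
move=> mD mf mg fg; congr fine; apply: ae_eq_integral => //.
- exact/measurable_EFinP.
- exact/measurable_EFinP.
- move: fg; apply: filterS; first exact: (ae_filter_ringOfSetsType mu).
  by move=> x /= -> _.
Qed.

End Primitive.

Section Regularity.
Context {R : realType}.
Notation leb := (@lebesgue_measure R).

Lemma continuous_sum (I : finType) (F : I -> R -> R) :
  (forall i, continuous (F i)) -> continuous (fun x => \sum_i F i x).
Proof.
move=> cF.
have -> : (fun y => \sum_i F i y) = \sum_i F i.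
  by apply/funext => y; rewrite fct_sumE.
elim/big_ind: _ => [|f g cf cg|i _]; last exact: cF.
- by move=> x; exact: cst_continuous.
- by move=> x; apply: continuousD; [exact: cf|exact: cg].
Qed.

(** Bootstrap: [u i] has a weak derivative [v i] in L^2, hence a continuous representative [U i]. By
    the system [v i] then has a continuous weak derivative [g i], hence a continuously
    differentiable representative [V i], of which [U i] is a primitive. *)
Lemma regular_representative (N : nat) (mu : 'I_N -> R) (u : 'I_N -> R -> R) :
  (forall i, H1 (u i)) -> solves_system mu u ->
  exists U V : 'I_N -> R -> R, [/\
    forall i, {ae leb, forall x, u i x = U i x},
    forall i, exists2 v, v \in Lfun leb 2%:E & {ae leb, forall x, v x = V i x},
    forall i (x : R), is_derive x 1 (U i) (V i x) &
    forall i (x : R), is_derive x 1 (V i)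
      (- (2 * (\sum_j U j x ^+ 2)) * U i x + - mu i * U i x)].
Proof.
move=> uH1 sys.
have mae : Filter (almost_everywhere leb) by exact: (ae_filter_ringOfSetsType leb).
have /choice[v hv] i : exists v : R -> R, v \in Lfun leb 2%:E /\
    forall phi, test_function phi ->
      distr_deriv (distr_of (u i)) phi = distr_of v phi.
  by case: (uH1 i) => _ [v v2 hv]; exists v.
have lu i : locally_integrable setT (u i).
  by apply: Lfun2_locally_integrable; case: (uH1 i).
have lv i : locally_integrable setT (v i).
  by apply: Lfun2_locally_integrable; case: (hv i).
have /choice[U hU] i : exists F : R -> R, {ae leb, forall x, u i x = F x} /\
    forall a b, a <= b -> F b - F a = \int[leb]_(x in `[a, b]) v i x.
  have [F F1 F2] := weak_derivative_primitive _ _ (lu i) (lv i) (hv i).2.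
  by exists F.
have cU i : continuous (U i) by apply: primitive_continuous (lv i) (hU i).2.
pose rho (x : R) := \sum_j U j x ^+ 2.
have crho : continuous rho.
  by apply: continuous_sum => j x; exact: (continuousM (cU j x) (cU j x)).
pose p i (x : R) := rho x * U i x.
have cp i : continuous (p i).
  by move=> x; apply: continuousM; [exact: crho|exact: cU].
pose g i (x : R) := - (2 * rho x) * U i x + - mu i * U i x.
have gE i x : g i x = (- 2) * p i x + - mu i * U i x by rewrite /g /p; ring.
have cg i : continuous (g i).
  have -> : g i = (fun x => (- 2) * p i x + - mu i * U i x).
    by apply/funext => x; exact: gE.
  move=> x; apply: cvgD; apply: cvgM;
    [exact: cvg_cst|exact: cp|exact: cvg_cst|exact: cU].
(* The second distributional derivative of [u i] becomes the first one of [v i] by testing the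
   definition of [v i] with [derive1 phi]; elsewhere [u] may be replaced by [U], which agrees with
   it almost everywhere. *)
have vg i phi : test_function phi ->
    distr_deriv (distr_of (v i)) phi = distr_of (g i) phi.
  move=> tphi; have := sys i _ tphi.
  have vE := (hv i).2 _ (test_function_derive1 _ tphi).
  rewrite /distr_deriv in vE *.
  have [c [d [M [mphi _ _]]]] := test_function_bounded _ tphi.
  have mu_ j : measurable_fun setT (u j) by case: (lu j).
  have mU j : measurable_fun setT (U j) by exact: continuous_measurable_fun.
  have -> : distr_of (u i) phi = distr_of (U i) phi.
    apply: (@ae_eq_Rintegral _ setT _ _ measurableT
      (measurable_funM (mu_ i) mphi) (measurable_funM (mU i) mphi)).
    by move: (hU i).1; apply: filterS => x /= ->.
  have -> : distr_of (fun x => (\sum_(j < N) u j x ^+ 2) * u i x) phi = distr_of (p i) phi.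
    have mrho : measurable_fun [set: R] (fun x => \sum_(j < N) u j x ^+ 2).
      by apply: measurable_sum => j; exact: measurable_funX.
    apply: (@ae_eq_Rintegral _ setT _ _ measurableT
      (measurable_funM (measurable_funM mrho (mu_ i)) mphi)
      (measurable_funM (continuous_measurable_fun (cp i)) mphi)).
    - have : {ae leb, forall x, forall j, u j x = U j x}.
        by apply: filter_forall => j; exact: (hU j).1.
      apply: filterS => x uU /=; rewrite /p /rho uU; congr (_ * _ * _).
      by apply: eq_bigr => j _; rewrite uU.
  have -> : distr_of (g i) phi = - 2 * distr_of (p i) phi + - mu i * distr_of (U i) phi.
    have ip := integrable_mul_test_function _ _ (continuous_locally_integrable _ (cp i)) tphi.
    have iU := integrable_mul_test_function _ _ (continuous_locally_integrable _ (cU i)) tphi.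
    rewrite /distr_of -!RintegralZl// -RintegralD//; first last.
    - exact: (integrableZl measurableT (- mu i) iU).
    - exact: (integrableZl measurableT (- 2) ip).
    by congr (Rintegral _ _ _); apply/funext => x; rewrite gE; ring.
  move: vE; move: (distr_of (u i) _) (distr_of (v i) _) (distr_of (p i) _)
    (distr_of (U i) _) => a b c' d'; lra.
have /choice[V hV] i : exists F : R -> R, {ae leb, forall x, v i x = F x} /\
    forall a b, a <= b -> F b - F a = \int[leb]_(x in `[a, b]) g i x.
  have lg := continuous_locally_integrable _ (cg i).
  have [F F1 F2] := weak_derivative_primitive _ _ (lv i) lg (vg i).
  by exists F.
have dV i := primitive_is_derive _ _ (cg i) (hV i).2.
have cV i : continuous (V i).
  by move=> x; apply/differentiable_continuous/derivable1_diffP; case: (dV i x).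
exists U, V; split => //.
- by move=> i; exact: (hU i).1.
- by move=> i; exists (v i); [exact: (hv i).1|exact: (hV i).1].
- move=> i; apply: primitive_is_derive (cV i) _ => a b ab.
  rewrite (hU i).2//; apply: ae_eq_Rintegral (hV i).1 => //.
    by apply: measurable_funS measurableT (@subsetT _ _) _; case: (lv i).
  apply: measurable_funS measurableT (@subsetT _ _) _.
  exact: continuous_measurable_fun.
Qed.

End Regularity.

(** * Tails of integrals *)

Section Tails.
Context {R : realType}.
Notation leb := (@lebesgue_measure R).
Implicit Types (f g : R -> R) (D : set (measurableTypeR R)).

Lemma ge0_subset_Rintegral f (A B : set (measurableTypeR R)) :
  measurable A -> measurable B -> leb.-integrable B (EFin \o f) ->
  (forall x, 0 <= f x) -> A `<=` B ->
  \int[leb]_(x in A) f x <= \int[leb]_(x in B) f x.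
Proof.
move=> mA mB iB f0 AB; rewrite /Rintegral.
have iA : leb.-integrable A (EFin \o f) by apply: integrableS iB.
apply: fine_le; [exact: integrable_fin_num|exact: integrable_fin_num|].
apply: ge0_subset_integral => //; first by case/integrableP: iB.
by move=> x _; rewrite lee_fin.
Qed.

Lemma norm_Rintegral_le f g D : measurable D ->
  leb.-integrable D (EFin \o f) -> leb.-integrable D (EFin \o g) ->
  (forall x, `|f x| <= g x) ->
  `|\int[leb]_(x in D) f x| <= \int[leb]_(x in D) g x.
Proof.
move=> mD fi gi fg; apply: le_trans (le_normr_Rintegral mD fi) _.
by apply: le_Rintegral => //; exact: integrable_norm.
Qed.

(** Dominated convergence: the restrictions of [g] to [D n] tend to 0 pointwise and are bounded by
    [|g|]. *)
Lemma Rintegral_tail_cvg0 g (D : nat -> set (measurableTypeR R)) :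
  (forall n, measurable (D n)) -> leb.-integrable setT (EFin \o g) ->
  (forall x, \forall n \near \oo, ~ D n x) ->
  \int[leb]_(x in D n) g x @[n --> \oo] --> 0.
Proof.
move=> mD ig nD.
have mg : measurable_fun [set: measurableTypeR R] g.
  by case/integrableP: ig => /measurable_EFinP.
have L : \int[leb]_x (g \_ (D n)) x @[n --> \oo] --> \int[leb]_(x in setT) (0 : R).
  apply: (dominated_cvg_Rintegral _ _ _ _ _ _ _ _ _ _ _ _ (integrable_norm ig)) => //.
  - move=> n; apply: (@measurable_restrictT _ _ _ _ (D n) g (mD n)).1.
    exact: measurable_funS mg.
  - move=> x _; apply: cvg_near_cst; apply: filterS (nD x) => n nDx.
    by rewrite patchE memNset.
  - by move=> n x _; rewrite patchE /=; case: ifP => _; rewrite ?normr0.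
rewrite Rintegral_cst// mul0r in L.
by under eq_fun do rewrite Rintegral_mkcond.
Qed.

(** Otherwise the integral of [|g|] over [D] would be at least [e] times an infinite measure. It
    provides points near infinity where the solution and its derivative are small, with no need for
    decay. *)
Lemma exists_small_value g D (e : R) : measurable D -> leb D = +oo%E ->
  leb.-integrable D (EFin \o g) -> 0 < e -> exists2 x, D x & g x <= e.
Proof.
move=> mD Doo /integrableP[mg ig] e0; apply: contrapT => H.
have H' x : D x -> e <= g x.
  by move=> Dx; rewrite leNgt; apply/negP => gx; apply: H; exists x => //; exact: ltW.
have : (\int[leb]_(x in D) e%:E <= \int[leb]_(x in D) `|(g x)%:E|)%E.
  apply: ge0_le_integral => //.
  - by move=> x _; rewrite lee_fin ltW.
  - by apply: measurableT_comp.
  - by move=> x Dx; rewrite lee_fin (le_trans (H' _ Dx))// ler_norm.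
have -> : (\int[leb]_(x in D) e%:E = +oo)%E.
  by rewrite integral_cst// [X in (_ * X)%E]Doo mulry gtr0_sg// mul1e.
by move=> /le_lt_trans /(_ ig).
Qed.

Lemma ae_eq_integrable f g : measurable_fun [set: measurableTypeR R] g ->
  {ae leb, forall x, f x = g x} ->
  leb.-integrable setT (EFin \o f) -> leb.-integrable setT (EFin \o g).
Proof.
move=> mg fg /integrableP[mf fi]; apply/integrableP; split.
  exact/measurable_EFinP.
rewrite -(@ae_eq_integral _ _ _ leb setT _ (fun x => `|(EFin \o f) x|%E)) //.
- by apply: measurableT_comp.
- by apply: measurableT_comp => //; exact/measurable_EFinP.
- move: fg; apply: filterS; first exact: (ae_filter_ringOfSetsType leb).
  by move=> x /= -> _.
Qed.

Lemma Lnorm2_Rintegral f (c : R) :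
  ('N[leb]_2%:E [EFin \o f])%E = c%:E -> \int[leb]_x (f x * f x) = c ^+ 2.
Proof.
move=> fc.
have c0 : 0 <= c by rewrite -lee_fin -fc Lnorm_ge0.
have := @powR_Lnorm _ _ _ leb (EFin \o f) 2 _; rewrite fc => /(_ _)E.
rewrite /Rintegral; have -> : (\int[leb]_x (f x * f x)%:E = \int[leb]_x `|(EFin \o f) x| `^ 2)%E.
  apply: eq_integral => x _ /=.
  by rewrite ?poweR_EFin powR_mulrn// real_normK ?num_real.
by rewrite -E// ?poweR_EFin powR_mulrn.
Qed.

End Tails.

(** * Nonexistence of orthogonal solutions of equal norm *)

Theorem mainTheorem7 (R : realType) (N : nat) (hN : (2 <= N)%N)
    (mu : 'I_N -> R)
    (mu_mono : forall i j : 'I_N, (i <= j)%N -> mu i <= mu j)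
    (mu_neg : forall i : 'I_N, mu i < 0) :
  ~ exists u : 'I_N -> R -> R,
      [/\ forall i, H1 (u i),
          solves_system mu u,
          forall i j : 'I_N, i != j ->
            \int[lebesgue_measure]_x (u i x * u j x) = 0 &
          exists2 c : R, c != 0 &
            forall i, 'N[lebesgue_measure]_2%:E [EFin \o u i]%E = c%:E].
Proof.
move=> [u [uH1 sys orth [c c0 unorm]]].
have [U [V [uU vV dU dV]]] := regular_representative _ _ _ uH1 sys.
have mu_ i : measurable_fun [set: R] (u i).
  by case: (uH1 i); rewrite inE => /andP[/[!inE]].
have cont (f g : R -> R) : (forall x : R, is_derive x 1 f (g x)) -> continuous f.
  by move=> fg x; apply/differentiable_continuous/derivable1_diffP; case: (fg x).
have cU i : continuous (U i) := cont _ _ (dU i).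
have cV i : continuous (V i) := cont _ _ (dV i).
have mU i : measurable_fun [set: R] (U i) := continuous_measurable_fun (cU i).
have mV i : measurable_fun [set: R] (V i) := continuous_measurable_fun (cV i).
have iU2 i : lebesgue_measure.-integrable setT (EFin \o (fun x => U i x ^+ 2)).
  apply: (@ae_eq_integrable _ (fun x => u i x ^+ 2)).
  - exact: (measurable_funX 2 (mU i)).
  - move: (uU i); apply: filterS; first exact: (ae_filter_ringOfSetsType (@lebesgue_measure R)).
    by move=> x /= ->.
  - by apply: Lfun2_integrable_sqr; case: (uH1 i).
have iV2 i : lebesgue_measure.-integrable setT (EFin \o (fun x => V i x ^+ 2)).
  have [v v2 vVi] := vV i.
  apply: (@ae_eq_integrable _ (fun x => v x ^+ 2)).
  - exact: (measurable_funX 2 (mV i)).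
  - move: vVi; apply: filterS.
    by move=> x /= ->.
  - exact: Lfun2_integrable_sqr.
(* A single integrable function controls everything at infinity: it dominates all products
   [U i x * U j x], and [S x <= e ^+ 2] makes every [U i x] and [V i x] at most [e] in absolute
   value. *)
pose S (x : R) : R := \sum_i (U i x ^+ 2 + V i x ^+ 2).
have S_ge i x : U i x ^+ 2 + V i x ^+ 2 <= S x.
  rewrite /S (bigD1 i)//= lerDl; apply: sumr_ge0 => j _.
  by rewrite addr_ge0 ?sqr_ge0.
have S0 x : 0 <= S x by apply: sumr_ge0 => j _; rewrite addr_ge0 ?sqr_ge0.
have iS : lebesgue_measure.-integrable setT (EFin \o S).
  have -> : EFin \o S = (fun x => \sum_(i < N) ((U i x ^+ 2)%:E + (V i x ^+ 2)%:E))%E.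
    by apply/funext => x; rewrite /= /S -sumEFin.
  apply: (integrable_sum measurableT) => i _.
  exact: (integrableD measurableT (iU2 i) (iV2 i)).
have UU_le i j x : `|U i x * U j x| <= S x.
  have := S_ge i x; have := S_ge j x; rewrite normrM.
  rewrite -[U i x ^+ 2]real_normK ?num_real// -[U j x ^+ 2]real_normK ?num_real//.
  have := sqr_ge0 (`|U i x| - `|U j x|); have := sqr_ge0 (V i x).
  have := sqr_ge0 (V j x); rewrite !expr2; nra.
have iUU i j : lebesgue_measure.-integrable setT (EFin \o (fun x => U i x * U j x)).
  apply: (le_integrable measurableT _ _ iS).
    by apply/measurable_EFinP; exact: (measurable_funM (mU i) (mU j)).
  by move=> x _; rewrite /= lee_fin [leRHS]ger0_norm.
have iUUD i j (D : set (measurableTypeR R)) : measurable D ->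
    lebesgue_measure.-integrable D (EFin \o (fun x => U i x * U j x)).
  by move=> mD; exact: (integrableS measurableT mD (@subsetT _ _) (iUU i j)).
have iSD (D : set (measurableTypeR R)) : measurable D -> lebesgue_measure.-integrable D (EFin \o S).
  by move=> mD; exact: (integrableS measurableT mD (@subsetT _ _) iS).
have UUint i j : \int[lebesgue_measure]_x (U i x * U j x) = c ^+ 2 *+ (i == j).
  transitivity (\int[lebesgue_measure]_x (u i x * u j x)).
    apply: (@ae_eq_Rintegral _ setT _ _ measurableT
      (measurable_funM (mU i) (mU j)) (measurable_funM (mu_ i) (mu_ j))).
    move: (uU i) (uU j); apply: filterS2.
      exact: (ae_filter_ringOfSetsType (@lebesgue_measure R)).
    by move=> x /= -> ->.
  have [<-|ij] := eqVneq i j; first by rewrite mulr1n; exact: Lnorm2_Rintegral.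
  by rewrite mulr0n orth.
pose G i j (x : R) := \int[lebesgue_measure]_(t in `]-oo, x]) (U i t * U j t).
have G_le i j x : `|G i j x| <= \int[lebesgue_measure]_(t in `]-oo, x]) S t.
  by apply: norm_Rintegral_le => //; [exact: iUUD|exact: iSD].
pose k i := Num.sqrt (- mu i).
have k2 i : k i ^+ 2 = - mu i by rewrite sqr_sqrtr// oppr_ge0 ltW.
have sq_le (a s e : R) : 0 < e -> a ^+ 2 <= s -> s <= e ^+ 2 -> `|a| <= e.
  move=> e0 as_ se; rewrite -ler_sqr ?nnegrE// ?(ltW e0)// real_normK ?num_real//.
  exact: (le_trans as_ se).
have natr_gt (x : R) : \forall n \near \oo, x < n%:R by exact: nbhs_infty_gtr.
(* The common squared norm [c ^+ 2] plays the role of [m]. *)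
apply: (@no_regular_solution R N k U V G (c ^+ 2)) => //.
- by move=> i x; rewrite k2; exact: dV.
- move=> i j x.
  have cUU : {for x, continuous (fun t => U i t * U j t)}.
    by apply: cvgM; [exact: cU|exact: cU].
  have := @continuous_FTC1 R (fun t => U i t * U j t) -oo%O x (x + 1) _
    (iUUD i j _ (measurable_itv _)) _ cUU.
  rewrite ltrDl ltr01 ltNyr => /(_ isT isT)[dG GE].
  by rewrite -GE derive1E; exact: derivableP.
- by move=> i j x; rewrite /G; under eq_Rintegral do rewrite mulrC.
- by move=> i; rewrite sqrtr_gt0 oppr_gt0.
- by rewrite exprn_even_gt0.
- exists (\int[lebesgue_measure]_x S x) => i j x; apply: le_trans (G_le i j x) _.
  exact: ge0_subset_Rintegral.
- move=> e e0.
  have L := @Rintegral_tail_cvg0 R S (fun n => `]-oo, - n%:R]%classic)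
    (fun n => measurable_itv _) iS.
  have [|n _ /(_ n (leqnn n)) nE] := (@cvgrPdist_le _ _ _ _ _ _ _).1 (L _) e e0.
    move=> x; apply: filterS (natr_gt (- x)) => n xn /=.
    by rewrite in_itv/= => xn'; lra.
  exists (- n%:R) => i j x xn; apply: le_trans (G_le i j x) _.
  rewrite /= sub0r normrN in nE.
  apply: le_trans (le_trans (ler_norm _) nE).
  apply: ge0_subset_Rintegral => //; first exact: iSD.
  by move=> t /=; rewrite !in_itv/= => /le_trans; apply.
- move=> e X e0.
  have [|x xX Sx] := @exists_small_value R S `]-oo, X]%classic (e ^+ 2) (measurable_itv _) _
    (iSD _ (measurable_itv _)) (exprn_gt0 2 e0).
    by rewrite lebesgue_measure_itv/= ltNyr.
  exists x; first by move: xX; rewrite /= in_itv.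
  move=> i; have := S_ge i x; have := sqr_ge0 (U i x); have := sqr_ge0 (V i x) => *.
  by split; apply: sq_le Sx => //; lra.
(* First [n] is chosen so that the integral of [S] beyond [n] is at most [e], then [x > n] with
   [S x <= e ^+ 2]. The distance from [G i j x] to its limit is the integral of [U i * U j] over
   []x, +oo[], which that tail dominates. *)
- move=> e e0.
  have L := @Rintegral_tail_cvg0 R S (fun n => `]n%:R, +oo[%classic)
    (fun n => measurable_itv _) iS.
  have [|n _ /(_ n (leqnn n)) nE] := (@cvgrPdist_le _ _ _ _ _ _ _).1 (L _) e e0.
    move=> x; apply: filterS (natr_gt x) => n xn /=.
    by rewrite in_itv/= andbT => xn'; lra.
  rewrite /= sub0r normrN in nE.
  have [|x xX Sx] := @exists_small_value R S `]n%:R, +oo[%classic (e ^+ 2) (measurable_itv _) _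
    (iSD _ (measurable_itv _)) (exprn_gt0 2 e0).
    by rewrite lebesgue_measure_itv/= ltry.
  exists x => i j; split.
    have := S_ge i x; have := sqr_ge0 (V i x) => *.
    by apply: sq_le Sx => //; lra.
  rewrite -UUint distrC.
  have := @Rintegral_itvB R (fun t => U i t * U j t) -oo%O +oo%O x.
  rewrite set_itvNyy => /(_ (iUU i j) isT isT) ->.
  apply: le_trans (le_trans (ler_norm _) nE).
  apply: le_trans (norm_Rintegral_le _ S _ _ _ _ _) _ => //.
  - exact: iUUD.
  - exact: iSD.
  apply: ge0_subset_Rintegral => //; first exact: iSD.
  move: xX; rewrite /= in_itv/= andbT => nx.
  by move=> t /=; rewrite !in_itv/= !andbT; exact: lt_trans.
Qed.
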